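(* Let $n>1$. The Hardy space $\mathcal H=H^2(\mathbb D^n)$ on the polydisc $\mathbb D^n$ in $\mathbb C^n$ fails to have the Invertible Multiplier Property.
   Context: $H^2(\mathbb D^n)$ is normed by $\|f\|^2=\int_{\mathbb T^n}|f|^2dm$ (boundary values), $m$ normalized Haar measure on $\mathbb T^n$; its normalized reproducing kernels are $\widetilde{k_a}(z)=\prod_{j=1}^n\sqrt{1-|a_j|^2}/(1-\overline{a_j}z_j)$, $a\in\mathbb D^n$. Invertible Multiplier Property for a Hilbert function space $\mathcal H$ on $\Omega$ with normalized reproducing kernels $\widetilde{k_a}$: for every $M\ge1$, $\mathbf a=(a_1,\dots,a_M)\in\Omega^M$ and nonnegative $\theta_0,\dots,\theta_M$ with $\sum_{m=0}^M\theta_m=1$, there is a normalized invertible multiplier $\psi$ of $\mathcal H$ (i.e. $\psi$ is nonvanishing, multiplication by $\psi$ and by $1/\psi$ map $\mathcal H$ to $\mathcal H$, and $\|\psi\|_{\mathcal H}=1$) such that $$\theta_0\langle f,g\rangle_{\mathcal H}+\sum_{m=1}^M\theta_m\langle\widetilde{k_{a_m}}f,\widetilde{k_{a_m}}g\rangle_{\mathcal H}=\langle\psi f,\psi g\rangle_{\mathcal H},\qquad f,g\in\mathcal H.$$ *)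

(* Defs.v *)
From HB Require Import structures.
From mathcomp Require Import all_boot all_order all_algebra.
From mathcomp Require Import complex.
From mathcomp Require Import all_classical all_reals all_analysis.

Set Implicit Arguments.
Unset Strict Implicit.
Unset Printing Implicit Defensive.

Import Order.TTheory GRing.Theory Num.Theory.
Import numFieldNormedType.Exports.
Import ComplexField.Normc.

Local Open Scope classical_set_scope.
Local Open Scope ring_scope.
Local Open Scope complex_scope.

(* R[i] packaged as a numClosedFieldType, so that it and 'rV[cplx R]_n carry
   the norm topology and [differentiable] means complex differentiability. *)
Definition cplx (R : realType) : numClosedFieldType := R[i].

(* A Hilbert function space on Omega is given by the set H of its elements,
   its inner product and its normalized kernels a |-> k a. Functions are total
   on the ambient type; only their values on Omega are meant to matter. *)
Section invertible_multiplier_property.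
Variables (R : realType) (T : Type) (Omega : set T).
Variables (H : set (T -> cplx R)).
Variables (ip : (T -> cplx R) -> (T -> cplx R) -> cplx R).
Variables (k : T -> T -> cplx R).

Definition ip_norm (f : T -> cplx R) : R := Num.sqrt (complex.Re (ip f f)).

Definition normalized_invertible_multiplier (psi : T -> cplx R) : Prop :=
  [/\ forall z, Omega z -> psi z != 0,
      forall f, H f -> H (fun z => psi z * f z),
      forall f, H f -> H (fun z => (psi z)^-1 * f z),
      H psi
    & ip_norm psi = 1].

(* The weight theta m.+1 goes with the point a m. *)
Definition invertible_multiplier_property : Prop :=
  forall (M : nat) (a : 'I_M -> T) (theta : 'I_M.+1 -> R),
    (1 <= M)%N ->
    (forall m, Omega (a m)) ->
    (forall m, 0 <= theta m) ->
    \sum_m theta m = 1 ->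
    exists psi, normalized_invertible_multiplier psi /\
      forall f g, H f -> H g ->
        (theta ord0)%:C * ip f g
        + \sum_(m < M) (theta (lift ord0 m))%:C
            * ip (fun z => k (a m) z * f z) (fun z => k (a m) z * g z)
        = ip (fun z => psi z * f z) (fun z => psi z * g z).

End invertible_multiplier_property.

Definition polydisc (R : realType) (n : nat) : set 'rV[cplx R]_n :=
  [set z | forall j, normc (z ord0 j) < 1].

(* T^n is parametrized by t in [0, 1]^n through
   t |-> (e^(2 i pi t_1), ..., e^(2 i pi t_n)); its normalized Haar measure is
   then the n-fold product of the uniform probability on [0, 1]. *)
Definition torus_point (R : realType) (n : nat)
    (t : n.-tuple (measurableTypeR R)) : 'rV[cplx R]_n :=
  \row_j (cos (2 * pi * (tnth t j : R)) +i* sin (2 * pi * (tnth t j : R))).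

Section haar.
Variable R : realType.

Definition cons_pair (n : nat)
    (x : measurableTypeR R * n.-tuple (measurableTypeR R)) :
  n.+1.-tuple (measurableTypeR R) := [the n.+1.-tuple _ of x.1 :: x.2].

Lemma measurable_cons_pair n : measurable_fun setT (@cons_pair n).
Proof. by apply: measurable_cons. Qed.

HB.instance Definition _ n :=
  isMeasurableFun.Build _ _ _ _ (@cons_pair n) (@measurable_cons_pair n).

Fixpoint haar (n : nat) : probability (n.-tuple (measurableTypeR R)) R :=
  if n is n'.+1 then
    distribution (uniform_prob (@ltr01 R) \x haar n')%E (@cons_pair n')
  else \d_[tuple].

End haar.

Section hardy_space.
Variables (R : realType) (n : nat).
Local Notation mu := (haar R n).
Implicit Types (f g : 'rV[cplx R]_n -> cplx R).
Implicit Types (F G : n.-tuple (measurableTypeR R) -> cplx R).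

Definition dilate (r : R) f : n.-tuple (measurableTypeR R) -> cplx R :=
  fun t => f (r%:C *: torus_point t).

Definition hardy : set ('rV[cplx R]_n -> cplx R) :=
  [set f | (forall z, polydisc z -> differentiable f z) /\
    exists B : R, forall r : R, 0 < r < 1 ->
      (\int[mu]_t (normc (dilate r f t) ^+ 2)%:E <= B%:E)%E].

(* Boundary values are taken in L^2(T^n): F is the limit, as r -> 1-, of the
   dilates zeta |-> f (r zeta). This determines F almost everywhere. *)
Definition is_boundary_value f F : Prop :=
  [/\ measurable_fun setT (fun t => complex.Re (F t) : R),
      measurable_fun setT (fun t => complex.Im (F t) : R),
      (\int[mu]_t (normc (F t) ^+ 2)%:E < +oo)%E
    & (\int[mu]_t (normc (dilate r f t - F t) ^+ 2)%:E)%E @[r --> 1^'-]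
        --> 0%E].

Definition boundary_value f : n.-tuple (measurableTypeR R) -> cplx R :=
  xget (fun=> 0) [set F | is_boundary_value f F].

Definition hardy_ip f g : cplx R :=
  let h t := boundary_value f t * (boundary_value g t)^* in
  (\int[mu]_t complex.Re (h t)) +i* (\int[mu]_t complex.Im (h t)).

Definition hardy_kernel (a z : 'rV[cplx R]_n) : cplx R :=
  \prod_j ((Num.sqrt (1 - normc (a ord0 j) ^+ 2))%:C
             / (1 - (a ord0 j)^* * z ord0 j)).

End hardy_space.

(* Main.v *)
Require Import Defs.
From mathcomp Require Import all_boot all_order all_algebra.
From mathcomp Require Import complex.
From mathcomp Require Import all_classical all_reals all_analysis.
From mathcomp Require Import measurable_realfun.
From mathcomp Require Import ring lra.

(** Take the point evaluations at (0, 1/2, 0, ...) and (1/2, 0, 0, ...) with weights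
    1/2. Writing u, v for the first two coordinates, A = 1 - v/2, B = 1 - u/2 and
    phi_1 = c / (A psi), phi_2 = c / (B psi) for the two kernels divided by psi,
    the identity applied to f = v / psi, g = A B u reduces, by orthogonality of
    monomials, to the vanishing of the u-derivative of phi_2 at the origin. Applied
    to f = u / psi, g = A B it relates phi_1(0) to the u-derivative at the origin of
    psi A B = c A / phi_2, which has just been shown to vanish; hence phi_1(0) = 0,
    although phi_1 has no zeros.

    The Fourier coefficients of dilates are computed by Fubini from the mean value
    property on circles. Since complex differentiability is only pointwise, the
    latter is proved as in Goursat's theorem, by bisecting rectangles in polar
    coordinates. No Fatou theorem is needed: psi has a boundary value because its
    norm is not the junk value 0, and 1 / psi has one because the identity for
    f = g = 1 / psi has a nonzero right-hand side. *)

Set Implicit Arguments.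
Unset Strict Implicit.
Unset Printing Implicit Defensive.

Import Order.TTheory GRing.Theory Num.Theory.
Import numFieldNormedType.Exports.
Import ComplexField.Normc.

Local Open Scope classical_set_scope.
Local Open Scope ring_scope.
Local Open Scope complex_scope.

(** The factor A B in g clears the denominators of both kernels, so the second entries of the kernel
    pairings become polynomials: c B u and c A u, then c B and c A. Dividing f by psi turns psi f
    into a monomial. In the two main identities each inner product therefore pairs one unknown
    holomorphic function with an explicit polynomial and reads off finitely many Taylor coefficients
    of the unknown; two unknown boundary values never have to be multiplied. The kernel 1/B leaves A
    behind, and c A u contains the mixed monomial uv: this is where the second variable enters. Only
    values and u-derivatives at the origin occur, so pointwise derivatives replace power series.
    Each pairing is computed exactly for the dilate of the unknown at radius r, and the limit r -> 1
    uses only mean square convergence against a bounded function. *)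

(** * Vanishing of additive, locally small functions of rectangles *)

Section bisection.
Variable R : realType.
Implicit Types (a b c d x y : R).

Lemma archi_halve (K e : R) : 0 <= K -> 0 < e -> exists n, K / 2 ^+ n <= e.
Proof.
move=> K0 e0; exists (Num.bound (K / e)).
have := archi_boundP (divr_ge0 K0 (ltW e0)).
set n := Num.bound _ => Kn.
rewrite ler_pdivrMr ?exprn_gt0// mulrC -ler_pdivrMr//.
by rewrite (le_trans (ltW Kn))// -natrX ler_nat ltnW// ltn_expl.
Qed.

Lemma nested_segments_point (s t : nat -> R) :
  (forall n, s n <= s n.+1) -> (forall n, t n.+1 <= t n) ->
  (forall n, s n <= t n) -> exists x, forall n, s n <= x <= t n.
Proof.
move=> hs ht st.
have hs' : {homo s : m n / (m <= n)%N >-> m <= n}.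
  by apply: homo_leq => //; exact: le_trans.
have ht' : {homo t : m n / (m <= n)%N >-> n <= m}.
  by apply: homo_leq => // y x z xy yz; exact: le_trans yz xy.
have smt m n : s m <= t n.
  rewrite (le_trans (hs' _ _ (leq_maxl m n)))// (le_trans (st _))//.
  exact: ht' (leq_maxr m n).
exists (sup (range s)) => n; apply/andP; split.
  apply: sup_upper_bound; last by exists n.
  by split; [exists (s 0%N), 0%N | exists (t 0%N) => _ [m _ <-]].
by apply: ge_sup; [exists (s 0%N), 0%N | move=> _ [m _ <-]].
Qed.

Variable E : R -> R -> R -> R -> R.
Variables a0 b0 c0 d0 : R.
Hypotheses (a0b0 : a0 <= b0) (c0d0 : c0 <= d0).
Hypothesis addx : forall a m b c d, a0 <= a -> a <= m -> m <= b -> b <= b0 ->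
  c0 <= c -> c <= d -> d <= d0 -> E a b c d = E a m c d + E m b c d.
Hypothesis addy : forall a b c m d, a0 <= a -> a <= b -> b <= b0 ->
  c0 <= c -> c <= m -> m <= d -> d <= d0 -> E a b c d = E a b c m + E a b m d.
Hypothesis loc : forall x y e, a0 <= x <= b0 -> c0 <= y <= d0 -> 0 < e ->
  exists2 del, 0 < del & forall a b c d, a0 <= a -> a <= x -> x <= b ->
    b <= b0 -> c0 <= c -> c <= y -> y <= d -> d <= d0 ->
    b - a <= del -> d - c <= del ->
    `|E a b c d| <= e * ((b - a) + (d - c)) ^+ 2.

Let rect := (R * R * (R * R))%type.
Let inside (q : rect) := [/\ a0 <= q.1.1, q.1.1 <= q.1.2 & q.1.2 <= b0] /\
  [/\ c0 <= q.2.1, q.2.1 <= q.2.2 & q.2.2 <= d0].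
Let size (q : rect) := (q.1.2 - q.1.1) + (q.2.2 - q.2.1).
Let bad e (q : rect) :=
  e * size q ^+ 2 < `|E q.1.1 q.1.2 q.2.1 q.2.2|.
Let half (q q' : rect) :=
  [/\ q.1.1 <= q'.1.1, q'.1.2 <= q.1.2, q.2.1 <= q'.2.1, q'.2.2 <= q.2.2 &
   q'.1.2 - q'.1.1 = (q.1.2 - q.1.1) / 2 /\
   q'.2.2 - q'.2.1 = (q.2.2 - q.2.1) / 2].

Let step e (q : rect) : 0 <= e -> inside q -> bad e q ->
  exists q', [/\ inside q', bad e q' & half q q'].
Proof.
move: q => [[a b] [c d]] e0 [[/= h1 h2 h3] [h4 h5 h6]].
rewrite /bad /size/=.
set m := (a + b) / 2; set n := (c + d) / 2.
have am : a <= m by rewrite /m; lra.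
have mb : m <= b by rewrite /m; lra.
have cn : c <= n by rewrite /n; lra.
have nd : n <= d by rewrite /n; lra.
set S := (X in e * X) => bE.
have [B|B1] := boolP (bad e ((a, m), (c, n))).
  exists ((a, m), (c, n)); split => //; rewrite /inside /half /=.
    by split; split; lra.
  by rewrite /m /n; split; try lra; split; lra.
have [B|B2] := boolP (bad e ((a, m), (n, d))).
  exists ((a, m), (n, d)); split => //; rewrite /inside /half /=.
    by split; split; lra.
  by rewrite /m /n; split; try lra; split; lra.
have [B|B3] := boolP (bad e ((m, b), (c, n))).
  exists ((m, b), (c, n)); split => //; rewrite /inside /half /=.
    by split; split; lra.
  by rewrite /m /n; split; try lra; split; lra.
have [B|B4] := boolP (bad e ((m, b), (n, d))).
  exists ((m, b), (n, d)); split => //; rewrite /inside /half /=.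
    by split; split; lra.
  by rewrite /m /n; split; try lra; split; lra.
(* Each quarter has half the half-perimeter, hence a fourth of its square, so four good quarters
   would make the whole rectangle good. *)
exfalso; move: B1 B2 B3 B4; rewrite /bad /size/= -!leNgt.
have -> : (m - a + (n - c)) ^+ 2 = S / 4 by rewrite /S /m /n; field.
have -> : (m - a + (d - n)) ^+ 2 = S / 4 by rewrite /S /m /n; field.
have -> : (b - m + (n - c)) ^+ 2 = S / 4 by rewrite /S /m /n; field.
have -> : (b - m + (d - n)) ^+ 2 = S / 4 by rewrite /S /m /n; field.
move=> B1 B2 B3 B4; move: bE.
rewrite (@addx a m b c d)//; [|lra..].
rewrite (@addy a m c n d)//; [|lra..].
rewrite (@addy m b c n d)//; [|lra..].
apply/negP; rewrite -leNgt.
rewrite (le_trans (ler_normD _ _))//.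
have := ler_normD (E a m c n) (E a m n d).
have := ler_normD (E m b c n) (E m b n d).
lra.
Qed.

(** Goursat's argument: a rectangle on which [E] is large relative to the squared half-perimeter has
    a quarter with the same defect, and the nested quarters shrink to a point where [loc] fails. As
    [loc] speaks only of rectangles containing the point, differentiability at each point will
    suffice. *)
Lemma rectangle_additive_eq0 : E a0 b0 c0 d0 = 0.
Proof.
apply/eqP; apply: contraT => E0.
pose q0 : rect := ((a0, b0), (c0, d0)).
have N0 : 0 < `|E a0 b0 c0 d0| by rewrite normr_gt0.
have s0 : 0 < 1 + size q0 ^+ 2 by rewrite ltr_pwDl// sqr_ge0.
(* The [1 +] covers degenerate rectangles and makes [q0] strictly bad: [e * size q0 ^+ 2] falls
   short of the modulus of [E] by exactly [e]. *)
pose e := `|E a0 b0 c0 d0| / (1 + size q0 ^+ 2).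
have e0 : 0 < e by rewrite divr_gt0.
have bad0 : bad e q0.
  rewrite /bad /e /=.
  have : `|E a0 b0 c0 d0| / (1 + size q0 ^+ 2) * (1 + size q0 ^+ 2) =
         `|E a0 b0 c0 d0| by rewrite divfK// gt_eqF.
  rewrite mulrDr mulr1 -/e; lra.
have ins0 : inside q0 by rewrite /inside/=; split; split.
have /choice[s sP] : forall q, exists q', inside q -> bad e q ->
    [/\ inside q', bad e q' & half q q'].
  move=> q; have [[iq bq]|nq] := pselect (inside q /\ bad e q).
    by have [q' ?] := step (ltW e0) iq bq; exists q'.
  by exists q => ? ?; exfalso; apply: nq.
pose u n := iter n s q0.
have uP n : inside (u n) /\ bad e (u n).
  by elim: n => //= n [i1 i2]; have [] := sP _ i1 i2.
have uh n : half (u n) (u n.+1) by have [i1 i2] := uP n; have [] := sP _ i1 i2.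
have ux n : (u n).1.2 - (u n).1.1 = (b0 - a0) / 2 ^+ n.
  elim: n => [|n IH]; first by rewrite expr0 divr1.
  have [_ _ _ _ [-> _]] := uh n.
  by rewrite IH exprS; field; rewrite expf_neq0.
have uy n : (u n).2.2 - (u n).2.1 = (d0 - c0) / 2 ^+ n.
  elim: n => [|n IH]; first by rewrite expr0 divr1.
  have [_ _ _ _ [_ ->]] := uh n.
  by rewrite IH exprS; field; rewrite expf_neq0.
have [x xP] : exists x, forall n, (u n).1.1 <= x <= (u n).1.2.
  apply: (nested_segments_point (s := fun n => (u n).1.1)
     (t := fun n => (u n).1.2)) => n; try by have [] := uh n.
  by have [[[]]] := uP n.
have [y yP] : exists y, forall n, (u n).2.1 <= y <= (u n).2.2.
  apply: (nested_segments_point (s := fun n => (u n).2.1)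
     (t := fun n => (u n).2.2)) => n; try by have [] := uh n.
  by have [[_ []]] := uP n.
have [del del0 H] := loc (xP 0%N) (yP 0%N) e0.
have K0 : 0 <= (b0 - a0) + (d0 - c0) by rewrite addr_ge0 ?subr_ge0.
have [n Kn] := archi_halve K0 del0.
have p0 : 0 < (2 ^+ n : R)^-1 by rewrite invr_gt0 exprn_gt0.
have [[i1 i2] b1] := uP n; have /andP[x1 x2] := xP n; have /andP[y1 y2] := yP n.
have sx : (u n).1.2 - (u n).1.1 <= del.
  rewrite ux; apply: le_trans Kn; rewrite ler_pM2r// ?lerDl ?lerDr ?subr_ge0 //.
have sy : (u n).2.2 - (u n).2.1 <= del.
  rewrite uy; apply: le_trans Kn; rewrite ler_pM2r// ?lerDl ?lerDr ?subr_ge0 //.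
have [j1 j2 j3] := i1; have [j4 j5 j6] := i2.
have := H _ _ _ _ j1 x1 x2 j3 j4 y1 y2 j6 sx sy.
by rewrite leNgt; move: b1; rewrite /bad /size => ->.
Qed.

End bisection.

(** * Moduli and the parametrized unit circle *)

Section complex_moduli.
Variable R : realType.
Implicit Types (z w : R[i]) (r x y : R).

Lemma normc_ge_ReIm z : `|complex.Re z| <= normc z /\ `|complex.Im z| <= normc z.
Proof.
case: z => a b /=; split.
  by rewrite -sqrtr_sqr ler_wsqrtr// lerDl sqr_ge0.
by rewrite -sqrtr_sqr ler_wsqrtr// lerDr sqr_ge0.
Qed.

Lemma normc_ge0 z : 0 <= normc z.
Proof. by case: z => a b /=; rewrite sqrtr_ge0. Qed.

Lemma normc_real r : normc r%:C = `|r|.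
Proof. by rewrite /= expr0n addr0 sqrtr_sqr. Qed.

Lemma normc_le_ReIm z : normc z <= `|complex.Re z| + `|complex.Im z|.
Proof.
case: z => a b /=.
rewrite -[leRHS]ger0_norm ?addr_ge0// -sqrtr_sqr ler_wsqrtr//.
rewrite sqrrD !real_normK ?num_real// lerD2r lerDl.
by rewrite mulrn_wge0// mulr_ge0.
Qed.

Lemma normc_distC z w : normc (z - w) = normc (w - z).
Proof. by rewrite -normcN opprB. Qed.

Lemma normc_triangle z w u : normc (z - u) <= normc (z - w) + normc (w - u).
Proof. by rewrite (le_trans _ (le_normcD _ _))// addrA subrK. Qed.

Definition cis y : R[i] := cos (2 * pi * y) +i* sin (2 * pi * y).

Lemma normc_cis y : normc (cis y) = 1.
Proof. by rewrite /= cos2Dsin2 sqrtr1. Qed.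

Lemma normc_polar r y : normc (r%:C * cis y) = `|r|.
Proof. by rewrite normcM normc_cis mulr1 normc_real. Qed.

Lemma cis0 : cis 0 = 1.
Proof. by rewrite /cis mulr0 cos0 sin0. Qed.

Lemma cis1 : cis 1 = 1.
Proof. by rewrite /cis mulr1 mulrC mulr_natr cos2pi sin2pi. Qed.

Lemma lipschitz_derive (f df : R -> R) (K : R) x y :
  (forall u : R, is_derive u 1 f (df u)) -> (forall u, `|df u| <= K) ->
  `|f x - f y| <= K * `|x - y|.
Proof.
move=> fd dK.
wlog yx : x y / y <= x => [H|].
  case: (leP y x) => [/H//|xy]; rewrite distrC [`|x - y|]distrC.
  exact: H (ltW xy).
have [|c _ ->] := MVT_segment yx (fun u _ => fd u).
  by apply: derivable_within_continuous => u _; have := fd u => -[].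
by rewrite normrM ler_wpM2r.
Qed.

(** The constant adds the Lipschitz constants 2 pi of the cosine and sine coordinates. *)
Lemma normc_cisB x y : normc (cis x - cis y) <= 4 * pi * `|x - y|.
Proof.
rewrite (le_trans (normc_le_ReIm _))//=.
have K0 : 0 <= 2 * pi :> R by rewrite mulr_ge0 ?pi_ge0.
have h1 : `|cos (2 * pi * x) - cos (2 * pi * y)| <= 2 * pi * `|x - y|.
  have := lipschitz_derive (2 * pi * x) (2 * pi * y) (@is_derive_cos R) (K := 1).
  rewrite -mulrBr normrM (ger0_norm K0) mul1r; apply => u.
  by rewrite normrN ler_norml sin_geN1 sin_le1.
have h2 : `|sin (2 * pi * x) - sin (2 * pi * y)| <= 2 * pi * `|x - y|.
  have := lipschitz_derive (2 * pi * x) (2 * pi * y) (@is_derive_sin R) (K := 1).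
  rewrite -mulrBr normrM (ger0_norm K0) mul1r; apply => u.
  by rewrite ler_norml cos_geN1 cos_le1.
by rewrite (le_trans (lerD h1 h2))//; lra.
Qed.

End complex_moduli.

(** * Integrals over segments *)

Section segment_integral.
Variable R : realType.
Implicit Types (f g F : R -> R) (a b c x r : R).
Local Notation mu := (@lebesgue_measure R).

Definition segint f a b := \int[mu]_(x in `[a, b]) f x.
Definition segintegrable f a b := mu.-integrable `[a, b] (EFin \o f).

Lemma cts_segintegrable f a b :
  (forall x, a <= x <= b -> {for x, continuous f}) -> segintegrable f a b.
Proof.
move=> fc; apply: continuous_compact_integrable; first exact: segment_compact.
apply: continuous_in_subspaceT => x /[!inE]/=.
by rewrite in_itv/= => /fc.
Qed.

Lemma segint_split f a m b : a <= m -> m <= b -> segintegrable f a b ->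
  segint f a b = segint f a m + segint f m b.
Proof.
move=> am mb fi; have := @Rintegral_itvB _ f (BLeft a) (BRight b) m fi.
rewrite !bnd_simp => /(_ am mb) e.
rewrite /segint -[X in _ = _ + X]Rintegral_itv_obnd_cbnd.
  by rewrite -e addrC subrK.
apply: integrableS fi => //.
by apply: subset_itv; rewrite bnd_simp.
Qed.

Lemma segintB f g a b : segintegrable f a b -> segintegrable g a b ->
  segint (fun x => f x - g x) a b = segint f a b - segint g a b.
Proof. by move=> fi gi; rewrite /segint RintegralB. Qed.

Lemma segintegrableB f g a b : segintegrable f a b -> segintegrable g a b ->
  segintegrable (fun x => f x - g x) a b.
Proof.
move=> fi gi; have := integrableB _ fi gi => /(_ (measurable_itv _)).
by apply: eq_integrable => // x _ /=; rewrite EFinB.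
Qed.

Lemma segint_cst a b r : a <= b -> segint (fun=> r) a b = r * (b - a).
Proof.
move=> ab; rewrite /segint Rintegral_cst//= lebesgue_measure_itv/= lte_fin.
move: ab; rewrite le_eqVlt => /predU1P[->|ab]; first by rewrite ltxx subrr.
by rewrite ab.
Qed.

Lemma segint_bound f a b (K : R) : a <= b -> segintegrable f a b ->
  (forall x, a <= x <= b -> `|f x| <= K) -> `|segint f a b| <= K * (b - a).
Proof.
move=> ab fi fK; rewrite (le_trans (le_normr_Rintegral _ _))//.
rewrite -segint_cst//; apply: le_Rintegral => //.
- have := integrable_abse fi; apply: eq_integrable => // x _.
- by apply: (@cts_segintegrable (fun=> K)) => x _; exact: cst_continuous.
Qed.

Lemma segint_FTC f F a b : a <= b -> continuous f ->
  (forall x, is_derive x 1 F (f x)) -> segint f a b = F b - F a.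
Proof.
rewrite le_eqVlt => /predU1P[<-|ab] fc Fd.
  by rewrite /segint set_itv1 Rintegral_set1 subrr.
rewrite /segint /Rintegral (@continuous_FTC2 _ f F a b ab) //.
- by apply: continuous_subspaceT.
- have Fc : continuous F.
    move=> x; apply: differentiable_continuous; apply/derivable1_diffP.
    by have := Fd x => -[].
  split; first by move=> x _; have := Fd x => -[].
    by apply: cvg_at_right_filter; exact: Fc.
  by apply: cvg_at_left_filter; exact: Fc.
- by move=> x _; rewrite derive1E; have := Fd x => -[].
Qed.

End segment_integral.

(** * Cauchy's theorem in polar coordinates and means over circles *)

Section circle_mean.
Variable R : realType.
Implicit Types (g : R[i] -> R[i]) (z w be al : R[i]) (r x y a b c d e : R).

(** Differentiability at a single point, phrased with real-valued moduli: the local affine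
    approximation that the bisection consumes. *)
Definition cdiff g w0 := exists be, forall e : R, 0 < e -> exists2 del : R, 0 < del &
  forall w, normc (w - w0) < del ->
    normc (g w - g w0 - be * (w - w0)) <= e * normc (w - w0).

Lemma cdiff_cont g w0 : cdiff g w0 -> forall e : R, 0 < e -> exists2 del : R, 0 < del &
  forall w, normc (w - w0) < del -> normc (g w - g w0) < e.
Proof.
move=> [be gd] e e0; have [del del0 H] := gd 1 ltr01.
have K0 : 0 < 1 + normc be by rewrite ltr_pwDl// normc_ge0.
exists (Num.min del (e / (1 + normc be))).
  by rewrite lt_min del0 divr_gt0.
move=> w; rewrite lt_min => /andP[/H h1]; rewrite ltr_pdivlMr// => h2.
rewrite (le_lt_trans _ h2)//.
rewrite -[X in normc X](subrK (be * (w - w0))).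
rewrite (le_trans (le_normcD _ _))// normcM; lra.
Qed.

Lemma cdiff_path_cts g (u : R -> R[i]) (t K : R) : cdiff g (u t) ->
  (forall s, normc (u s - u t) <= K * `|s - t|) ->
  {for t, continuous (fun s => complex.Re (g (u s)))} /\
  {for t, continuous (fun s => complex.Im (g (u s)))}.
Proof.
move=> /cdiff_cont gc uK.
have K0 : 0 <= K.
  have := uK (t + 1); rewrite [t + 1]addrC addrK normr1 mulr1; apply: le_trans.
  exact: normc_ge0.
have key e : 0 < e -> \forall s \near t, normc (g (u s) - g (u t)) < e.
  move=> /gc[del del0 H].
  have p0 : 0 < del / (K + 1) by rewrite divr_gt0// ltr_wpDl.
  have : \forall s \near t, `|t - s| < del / (K + 1) by apply/nbhs_ballP; exists (del / (K + 1)).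
  apply: filterS => s; rewrite ltr_pdivlMr ?ltr_wpDl// => st; apply: H.
  rewrite (le_lt_trans (uK s))// (le_lt_trans _ st)// mulrC distrC ler_wpM2l//.
  by rewrite lerDl.
have ReB (z w : R[i]) : complex.Re z - complex.Re w = complex.Re (z - w) by case: z w => ? ? [].
have ImB (z w : R[i]) : complex.Im z - complex.Im w = complex.Im (z - w) by case: z w => ? ? [].
split; apply/cvgrPdist_lt => e /key; apply: filterS => s.
  apply: le_lt_trans; rewrite ReB normc_distC.
  by have [] := normc_ge_ReIm (g (u t) - g (u s)).
apply: le_lt_trans; rewrite ImB normc_distC.
by have [] := normc_ge_ReIm (g (u t) - g (u s)).
Qed.

Lemma ImM_cis_is_derive be y :
  is_derive y 1 (fun y => complex.Im (be * cis y) / (2 * pi))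
    (complex.Re (be * cis y)).
Proof.
case: be => b1 b2 /=.
have pi0 : pi != 0 :> R by rewrite gt_eqF// pi_gt0.
have dl (u : R) : is_derive u 1 (fun u : R => 2 * pi * u) (2 * pi).
  by have := is_deriveZ (2 * pi) (is_derive_id u 1); rewrite scaler1.
have dc : is_derive y 1 (fun y : R => cos (2 * pi * y))
   (2 * pi * - sin (2 * pi * y)).
  exact: is_derive_eq (is_derive1_comp (is_derive_cos _) (dl y)) (mulrC _ _).
have ds : is_derive y 1 (fun y : R => sin (2 * pi * y))
   (2 * pi * cos (2 * pi * y)).
  exact: is_derive_eq (is_derive1_comp (is_derive_sin _) (dl y)) (mulrC _ _).
apply: is_derive_eq.
rewrite scaler0 add0r.
rewrite /GRing.scale/=.
move: pi0 => {dl dc ds}; set S := sin _; set C := cos _; move: S C.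
by move: (pi : R) => p S C p0; field.
Qed.

Variable g : R[i] -> R[i].
Hypothesis g_cdiff : forall w, 0 < normc w < 1 -> cdiff g w.

(** With w = x cis y, the form P dx + Q dy is the real part of g dw / (2 pi i w), which is closed
    where g is holomorphic; integrating [Q] over a full turn gives the real part of the circle
    mean. *)
Let Q x y := complex.Re (g (x%:C * cis y)).
Let P x y := complex.Im (g (x%:C * cis y)) / (2 * pi * x).

Let polarB x y x0 y0 : 0 <= x0 <= 1 ->
  normc (x%:C * cis y - x0%:C * cis y0) <= `|x - x0| + 4 * pi * `|y - y0|.
Proof.
move=> /andP[x0ge x0le].
have -> : x%:C * cis y - x0%:C * cis y0 =
    (x - x0)%:C * cis y + x0%:C * (cis y - cis y0).
  by rewrite rmorphB/=; ring.
rewrite (le_trans (le_normcD _ _))// normc_polar lerD2l normcM normc_real.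
rewrite ger0_norm// (le_trans (ler_wpM2l x0ge (normc_cisB y y0)))//.
by rewrite ler_piMl// !mulr_ge0// pi_ge0.
Qed.

Let pol_in x y : 0 < x < 1 -> 0 < normc (x%:C * cis y) < 1.
Proof. by move=> /andP[x0 x1]; rewrite normc_polar gtr0_norm// x0. Qed.

Let Q_cts x : 0 < x < 1 -> continuous (Q x).
Proof.
move=> x01 y.
have [] // := @cdiff_path_cts g (fun y => x%:C * cis y) y (4 * pi).
  exact/g_cdiff/pol_in.
move=> s; have /andP[x0 x1] := x01.
have := @polarB x s x y; rewrite subrr normr0 add0r; apply.
by rewrite !ltW.
Qed.

Let P_cts x y : 0 < x < 1 -> {for x, continuous (P ^~ y)}.
Proof.
move=> /[dup] x01 /andP[x0 x1].
have pi0 : pi != 0 :> R by rewrite gt_eqF// pi_gt0.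
have [_ H] := @cdiff_path_cts g (fun x => x%:C * cis y) x 1
  (g_cdiff (pol_in y x01))
  (fun s => ltac:(
    have := @polarB s y x y ltac:(by rewrite !ltW);
    rewrite subrr normr0 mulr0 addr0 mul1r; apply)).
apply: continuousM => //.
apply: continuousV; first by rewrite !mulf_neq0// gt_eqF.
by apply: continuousM; [exact: cst_continuous|exact: cvg_id].
Qed.

(* [Qt] and [Pt] are [Q] and [P] for the affine map [w |-> al + be * w]; their
   rectangle defect vanishes, and they approximate [Q] and [P] near a point. *)
Let Qt al be x y := complex.Re (al + be * (x%:C * cis y)).
Let Pt al be x y := complex.Im (al + be * (x%:C * cis y)) / (2 * pi * x).

Let Qt_int al be x c d : c <= d ->
  segintegrable (Qt al be x) c d /\
  segint (Qt al be x) c d = complex.Re al * (d - c) +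
   x * (complex.Im (be * cis d) / (2 * pi) - complex.Im (be * cis c) / (2 * pi)).
Proof.
move=> cd.
have QE : Qt al be x = fun y => complex.Re al + x * complex.Re (be * cis y).
  apply/funext => y; rewrite /Qt; case: al be => a1 a2 [b1 b2] /=; ring.
have dK y : is_derive y 1 (fun y => complex.Re al * y +
    x * (complex.Im (be * cis y) / (2 * pi))) (Qt al be x y).
  have H1 := is_deriveZ (complex.Re al) (is_derive_id y 1).
  have H2 := is_deriveZ x (ImM_cis_is_derive be y).
  have := is_deriveD H1 H2; rewrite QE => H.
  by apply: is_derive_eq H _; rewrite /GRing.scale/= mulr1.
have cQ : continuous (Qt al be x).
  rewrite QE; case: be {QE dK} => b1 b2 /= y.
  have cl : continuous (fun y : R => 2 * pi * y) by exact: mulrl_continuous.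
  have cc := continuous_comp (cl y) (@continuous_cos R _).
  have cs := continuous_comp (cl y) (@continuous_sin R _).
  by apply: cvgD; [exact: cvg_cst|apply: cvgM; [exact: cvg_cst|]];
    apply: cvgB; apply: cvgM => //; exact: cvg_cst.
split; first by apply: cts_segintegrable => y _; exact: cQ.
by rewrite (segint_FTC cd cQ dK); ring.
Qed.

Let Pt_cts al be y x : 0 < x -> {for x, continuous (Pt al be ^~ y)}.
Proof.
move=> x0.
have pi0 : pi != 0 :> R by rewrite gt_eqF// pi_gt0.
have Pt1 : (Pt al be)^~ y = fun x => (complex.Im al + x * complex.Im (be * cis y)) / (2 * pi * x).
  apply/funext => u; rewrite /Pt; congr (_ / _).
  by case: al be => a1 a2 [b1 b2] /=; ring.
rewrite Pt1; apply: continuousM.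
  by apply: cvgD; [exact: cvg_cst|apply: cvgM; [exact: cvg_id|exact: cvg_cst]].
apply: continuousV; first by rewrite !mulf_neq0// gt_eqF.
by apply: continuousM; [exact: cst_continuous|exact: cvg_id].
Qed.

(** Between the sides y = c and y = d the constant term cancels, and the x of the linear term
    cancels the x in the denominator: the integrand is constant. *)
Let Pt_int al be a b c d : 0 < a -> a <= b ->
  segint (Pt al be ^~ d) a b - segint (Pt al be ^~ c) a b =
   (b - a) * (complex.Im (be * cis d) / (2 * pi) - complex.Im (be * cis c) / (2 * pi)).
Proof.
move=> a0 ab.
have pi0 : pi != 0 :> R by rewrite gt_eqF// pi_gt0.
have ip y : segintegrable (Pt al be ^~ y) a b.
  by apply: cts_segintegrable => x /andP[ax _]; apply: Pt_cts; exact: lt_le_trans ax.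
rewrite -segintB// mulrC -segint_cst//; apply: eq_Rintegral => x.
rewrite inE/= in_itv/= => /andP[ax _].
have x0 : x != 0 by rewrite gt_eqF// (lt_le_trans a0).
rewrite /Pt; case: al be {ip} => a1 a2 [b1 b2] /=.
move: pi0; set S := sin _; set C := cos _; set S' := sin _; set C' := cos _.
move: S C S' C'; move: (pi : R) => p S C S' C' p0.
by move: (x : R) x0 {ax} => {}x x0; field; rewrite ?x0 ?p0.
Qed.

(** The counterclockwise integral of P dx + Q dy along the boundary of the rectangle. *)
Let E a b c d := (segint (Q b) c d - segint (Q a) c d)
  - (segint (P ^~ d) a b - segint (P ^~ c) a b).

Let Q_int x c d : 0 < x < 1 -> segintegrable (Q x) c d.
Proof. by move=> x01; apply: cts_segintegrable => y _; exact: Q_cts. Qed.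

Let P_int a b y : 0 < a -> b < 1 -> segintegrable (P ^~ y) a b.
Proof.
move=> a0 b1; apply: cts_segintegrable => x /andP[ax xb]; apply: P_cts.
by rewrite (lt_le_trans a0)//= (le_lt_trans xb).
Qed.

(** Removing the affine part of g at the point does not change the boundary integral; what remains
    is o(s) on sides of total length O(s), hence o(s^2). The lower bound [a0] on the radius controls
    the factor 1 / (2 pi x). *)
Let E_loc a0 x y e : 0 < a0 -> a0 <= x < 1 -> 0 < e ->
  exists2 del, 0 < del & forall a b c d, a0 <= a -> a <= x -> x <= b ->
    b < 1 -> c <= y -> y <= d -> b - a <= del -> d - c <= del ->
    `|E a b c d| <= e * ((b - a) + (d - c)) ^+ 2.
Proof.
move=> a0gt /andP[a0x x1] e0.
have pigt0 : 0 < pi :> R by exact: pi_gt0.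
have x01 : 0 < x < 1 by rewrite (lt_le_trans a0gt).
have [be gd] := g_cdiff (pol_in y x01).
set w0 := x%:C * cis y in gd.
pose K : R := 1 + 4 * pi.
have K0 : 0 < K by rewrite /K ltr_wpDr// mulr_ge0// ltW.
pose L := 1 + (2 * pi * a0)^-1.
have iL : 0 < (2 * pi * a0)^-1 by rewrite invr_gt0 !mulr_gt0.
have L0 : 0 < L by rewrite /L addr_gt0.
(* Two sides cost [e' * K * s] per unit length and two cost that divided by [2 * pi * a0]; the total
   is at most [e * s ^+ 2]. *)
pose e' := e / (2 * K * L).
have e'0 : 0 < e' by rewrite divr_gt0// !mulr_gt0.
have [del del0 H] := gd e' e'0.
(* Then [K * s] is at most [del / 2], which makes the distance to [w0] strictly less than [del]. *)
exists (del / (K * 4)); first by rewrite divr_gt0// mulr_gt0.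
move=> a b c d a0a ax xb b1 cy yd.
rewrite !ler_pdivlMr ?mulr_gt0// => bad dcd.
set s := (b - a) + (d - c).
have s0 : 0 <= s by rewrite /s; lra.
have ab : a <= b by lra.
have cd : c <= d by lra.
have sK : K * s < del by rewrite /s; nra.
have wB u v : a <= u <= b -> c <= v <= d ->
    normc (u%:C * cis v - w0) <= K * s.
  move=> /andP[au ub] /andP[cv vd].
  have x01' : 0 <= x <= 1 by case/andP: x01 => ? ?; rewrite !ltW.
  rewrite (le_trans (polarB u v y x01'))//.
  have h1 : `|u - x| <= b - a by rewrite ler_norml; apply/andP; split; lra.
  have h2 : `|v - y| <= d - c by rewrite ler_norml; apply/andP; split; lra.
  have -> : K * s = s + 4 * pi * s by rewrite /K; ring.
  apply: lerD; first by rewrite (le_trans h1)// /s; lra.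
  apply: ler_wpM2l; first by rewrite mulr_ge0// ltW.
  by rewrite (le_trans h2)// /s; lra.
pose al := g w0 - be * w0.
have gB u v : a <= u <= b -> c <= v <= d ->
    normc (g (u%:C * cis v) - (al + be * (u%:C * cis v))) <= e' * (K * s).
  move=> uab vcd; have := wB _ _ uab vcd => wBuv.
  have := H _ (le_lt_trans wBuv sK).
  have -> : g (u%:C * cis v) - g w0 - be * (u%:C * cis v - w0) =
    g (u%:C * cis v) - (al + be * (u%:C * cis v)) by rewrite /al; ring.
  by move=> /le_trans; apply; rewrite ler_pM2l.
have ReB (z w : R[i]) : complex.Re z - complex.Re w = complex.Re (z - w) by case: z w => ? ? [].
have ImB (z w : R[i]) : complex.Im z - complex.Im w = complex.Im (z - w) by case: z w => ? ? [].
have QB u : a <= u <= b ->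
    `|segint (Q u) c d - segint (Qt al be u) c d| <= e' * (K * s) * (d - c).
  move=> uab; have [i1 _] := Qt_int al be u cd.
  have u01 : 0 < u < 1 by case/andP: uab => ? ?; apply/andP; split; lra.
  rewrite -segintB//; last exact: Q_int.
  apply: segint_bound => //; first by apply: segintegrableB => //; exact: Q_int.
  move=> v vcd; apply: le_trans (gB u v uab vcd).
  by rewrite /Q /Qt ReB; have [] := normc_ge_ReIm
    (g (u%:C * cis v) - (al + be * (u%:C * cis v))).
have PB v : c <= v <= d ->
    `|segint (P ^~ v) a b - segint (Pt al be ^~ v) a b| <=
     e' * (K * s) / (2 * pi * a0) * (b - a).
  move=> vcd.
  have i1 : segintegrable (P ^~ v) a b by apply: P_int => //; lra.
  have i2 : segintegrable (Pt al be ^~ v) a b.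
    by apply: cts_segintegrable => u /andP[au _]; apply: Pt_cts; lra.
  rewrite -segintB//.
  apply: segint_bound => //; first exact: segintegrableB.
  move=> u uab; rewrite /P /Pt -mulrBl ImB normrM ler_pM//.
    by apply: le_trans (gB u v uab vcd); have [] := normc_ge_ReIm
      (g (u%:C * cis v) - (al + be * (u%:C * cis v))).
  have au : a0 <= u by case/andP: uab => ? _; exact: le_trans a0a _.
  have u0 : 0 < u by exact: lt_le_trans au.
  have pu0 : 0 < 2 * pi * u by rewrite !mulr_gt0.
  rewrite ger0_norm ?invr_ge0 ?(ltW pu0)//.
  by rewrite lef_pV2 ?posrE ?mulr_gt0// ler_pM2l ?mulr_gt0.
have Et : (segint (Qt al be b) c d - segint (Qt al be a) c d)
  - (segint (Pt al be ^~ d) a b - segint (Pt al be ^~ c) a b) = 0.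
  have [_ ->] := Qt_int al be b cd; have [_ ->] := Qt_int al be a cd.
  by rewrite Pt_int//; [ring|lra].
have q1 : `|segint (Q b) c d - segint (Qt al be b) c d| <= e' * (K * s) * (d - c).
  by apply: QB; rewrite ab lexx.
have q2 : `|segint (Q a) c d - segint (Qt al be a) c d| <= e' * (K * s) * (d - c).
  by apply: QB; rewrite ab lexx.
have p1 := PB d; have p2 := PB c; rewrite cd !lexx /= in p1 p2.
rewrite /E -[X in `|X|]subr0 -Et.
have -> : e * s ^+ 2 = 2 * (e' * (K * s) * s) * L.
  by rewrite /e'; field; rewrite !gt_eqF.
apply: (@le_trans _ _ (2 * (e' * (K * s) * (d - c)) +
   2 * (e' * (K * s) / (2 * pi * a0) * (b - a)))); last first.
  have T0 : 0 <= e' * (K * s) by rewrite (mulr_ge0 (ltW e'0))// mulr_ge0// ltW.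
  have h1 : e' * (K * s) * (d - c) <= e' * (K * s) * s.
    by rewrite ler_wpM2l// /s lerDr subr_ge0.
  have h2 : e' * (K * s) / (2 * pi * a0) * (b - a) <=
      e' * (K * s) / (2 * pi * a0) * s.
    by rewrite ler_wpM2l ?(mulr_ge0 T0 (ltW iL))// /s lerDl subr_ge0.
  rewrite [leRHS](_ : _ = 2 * (e' * (K * s) * s) +
    2 * (e' * (K * s) / (2 * pi * a0) * s)); last by rewrite /L; ring.
  by rewrite lerD// ler_pM2l.
have T (A B C D A' B' C' D' : R) : `|A - B - (C - D) - (A' - B' - (C' - D'))| <=
   `|A - A'| + `|B - B'| + (`|C - C'| + `|D - D'|).
  have -> : A - B - (C - D) - (A' - B' - (C' - D')) =
    (A - A') + (B' - B) + ((C' - C) + (D - D')) by ring.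
  rewrite (le_trans (ler_normD _ _))// lerD// (le_trans (ler_normD _ _))//.
    by rewrite [`|B' - B|]distrC.
  by rewrite [`|C' - C|]distrC.
rewrite (le_trans (T _ _ _ _ _ _ _ _))//.
have e2 (u : R) : 2 * u = u + u by ring.
rewrite (e2 (_ * (d - c))) (e2 (_ * (b - a))).
exact: lerD (lerD q1 q2) (lerD (p1 isT) (p2 isT)).
Qed.

Let E_eq0 a b : 0 < a -> a <= b -> b < 1 -> E a b 0 1 = 0.
Proof.
move=> a0 ab b1; apply: rectangle_additive_eq0 => //.
- move=> a' m b' c d aa am mb bb _ cd _; rewrite /E.
  rewrite (segint_split am mb); last by apply: P_int; lra.
  rewrite (segint_split am mb); last by apply: P_int; lra.
  ring.
- move=> a' b' c m d aa a'b' bb _ cm md _; rewrite /E.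
  rewrite (segint_split cm md); last by apply: Q_int; lra.
  rewrite (segint_split cm md); last by apply: Q_int; lra.
  ring.
move=> x y e /andP[ax xb] _ e0.
have [|del del0 H] := @E_loc a x y e a0 _ e0; first by rewrite ax (le_lt_trans xb).
exists del => // a' b' c d aa ax' xb' bb _ cy yd _ h1 h2.
by apply: H => //; exact: le_lt_trans bb b1.
Qed.

Lemma circle_mean_punctured (L : R[i]) (r : R) : 0 < r < 1 ->
  (forall e : R, 0 < e -> exists2 del : R, 0 < del &
     forall w, 0 < normc w < del -> normc (g w - L) <= e) ->
  segint (fun y => complex.Re (g (r%:C * cis y))) 0 1 = complex.Re L.
Proof.
move=> /andP[r0 r1] gL; apply/eqP; rewrite -subr_eq0 -normr_le0.
apply/ler_addgt0Pr => e e0; rewrite add0r.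
have [del del0 H] := gL e e0.
pose s := Num.min r (del / 2).
have s0 : 0 < s by rewrite lt_min r0 divr_gt0.
have sr : s <= r by rewrite ge_min lexx.
have sdel : s < del by rewrite gt_min ltr_pdivrMr// mulr_natr mulr2n ltrDl del0 orbT.
have := E_eq0 s0 sr r1; rewrite /E.
have -> : P ^~ 1 = P ^~ 0 by apply/funext => x; rewrite /P cis0 cis1.
rewrite subrr subr0 => /eqP; rewrite subr_eq0 => /eqP.
rewrite {1}/segint -/(segint _ 0 1) => ->.
rewrite -[complex.Re L]mulr1 -[X in _ * X]subr0 -segint_cst// -segintB//.
- rewrite -[e]mulr1 -[X in _ * X](subr0 (1 : R)).
  apply: segint_bound => //.
    apply: segintegrableB; first by apply: Q_int; rewrite s0 (le_lt_trans sr).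
    by apply: cts_segintegrable => x _; exact: cst_continuous.
  move=> y _; have := H (s%:C * cis y); rewrite normc_polar gtr0_norm// s0 sdel.
  move=> /(_ isT); apply: le_trans; rewrite /Q.
  have [] := normc_ge_ReIm (g (s%:C * cis y) - L).
  by case: (g _) L {gL H} => ? ? [? ?].
- by apply: Q_int; rewrite s0 (le_lt_trans sr).
- by apply: cts_segintegrable => x _; exact: cst_continuous.
Qed.

End circle_mean.

(** * Measurability of continuous functions of a tuple *)

Section continuous_tuple_measurable.
Variable R : realType.
Local Notation T n := (n.-tuple (measurableTypeR R)).

Definition tuple_cts n (F : T n -> R) := forall t (e : R), 0 < e ->
  exists2 del : R, 0 < del & forall t' : T n,
    (forall j, `|(tnth t' j : R) - tnth t j| < del) -> `|F t' - F t| < e.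

Let q (N : nat) (x : R) : R := (Num.floor (N.+1%:R * x))%:~R / N.+1%:R.

Let q_near N x : `|q N x - x| <= N.+1%:R^-1.
Proof.
have /andP[h1 h2] := floor_itv (N.+1%:R * x).
have N0 : 0 < N.+1%:R :> R by rewrite ltr0n.
have -> : q N x - x = ((Num.floor (N.+1%:R * x))%:~R - N.+1%:R * x) / N.+1%:R.
  by rewrite /q mulrBl [N.+1%:R * x]mulrC mulfK ?gt_eqF.
rewrite normrM [`|_^-1|]gtr0_norm ?invr_gt0// ler_piMl ?invr_ge0 ?(ltW N0)//.
by move: h2; rewrite ler_norml intrD => h2; apply/andP; split; lra.
Qed.

Let tcons n x (t : T n) : T n.+1 := [the n.+1.-tuple (measurableTypeR R) of x :: t].

Let gq N n (t : T n) : T n := map_tuple (q N) t.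

(* Only the values of G on a countable grid of points are used. *)
Let grid_measurable N n (G : T n -> R) :
  measurable_fun setT (fun t : T n => G (gq N t)).
Proof.
elim: n G => [|n IH] G.
  rewrite (_ : (fun _ => _) = cst (G [tuple])); first exact: measurable_cst.
  by apply/funext => t; congr G; apply: val_inj; rewrite /= tuple0.
move=> _ Y mY; rewrite setTI.
(* Slicing by the integer part of the first rescaled coordinate gives countably many slices, on each
   of which the function depends on the tail alone. *)
rewrite (_ : _ @^-1` _ = \bigcup_(k : int)
  (((fun t : T n.+1 => Num.floor (N.+1%:R * (tnth t ord0 : R))) @^-1` [set k]) `&`
   ((fun t : T n.+1 => [tuple of behead t] : T n) @^-1`
     ((fun t => G (tcons (k%:~R / N.+1%:R)
        (gq N t))) @^-1` Y)))).
  apply: countable_bigcupT_measurable => [|k]; first exact: countableP.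
  apply: measurableI.
    have N0 : 0 < N.+1%:R :> R by rewrite ltr0n.
    have -> : (fun t : T n.+1 => Num.floor (N.+1%:R * (tnth t ord0 : R))) @^-1` [set k]
      = setT `&` (fun t : T n.+1 => tnth t ord0) @^-1`
        (`[(k%:~R / N.+1%:R : R), ((k + 1)%:~R / N.+1%:R : R)[%classic).
      apply/seteqP; rewrite setTI; split => t /=; rewrite in_itv/=.
        move=> <-; have /andP[h1 h2] := floor_itv (N.+1%:R * (tnth t ord0 : R)).
        by rewrite ler_pdivrMr// ltr_pdivlMr// [_ * N.+1%:R]mulrC h1.
      rewrite ler_pdivrMr// ltr_pdivlMr// [_ * N.+1%:R]mulrC => h.
      exact: floor_def.
    exact: (measurable_tnth ord0).
  rewrite -[X in measurable X]setTI; apply: measurable_behead => //.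
  by rewrite -[X in measurable X]setTI; exact: (IH (fun t => G (tcons _ t))).
apply/seteqP; split => [t /= Yt|t [k _ [/= tk]]].
  exists (Num.floor (N.+1%:R * (tnth t ord0 : R))) => //; split => //=.
  by move: Yt; case/tupleP: t => x t; congr (Y (G _)); apply: val_inj.
case/tupleP: t tk => x t; rewrite (tnth_nth 0)/= => tk.
by congr (Y (G _)); apply: val_inj; rewrite /= /q tk.
Qed.

(** Measurable sets of tuples are handled through coordinates rather than open sets, so F is
    obtained as the pointwise limit of its composites with rounding to multiples of 1 / (N + 1). *)
Lemma tuple_cts_measurable n (F : T n -> R) : tuple_cts F -> measurable_fun setT F.
Proof.
move=> Fc.
apply: (measurable_fun_cvg (h := fun N t => F (gq N t))).
  by move=> N; exact: grid_measurable.
move=> t _; apply/cvgrPdist_lt => e e0.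
have [del del0 H] := Fc t e e0.
have := near_infty_natSinv_lt (PosNum del0).
apply: filterS => N /= hN.
rewrite distrC; apply: H => j; rewrite tnth_map.
exact: le_lt_trans (q_near N _) hN.
Qed.

End continuous_tuple_measurable.

(** * Fubini for the Haar measure of the torus *)

Section haar_integral.
Variable R : realType.
Local Notation mu := (@lebesgue_measure R).
Local Notation U := (uniform_prob (@ltr01 R)).
Local Notation T n := (n.-tuple (measurableTypeR R)).

Definition tcons n (x : measurableTypeR R) (t : T n) : T n.+1 := cons_pair (x, t).

Lemma integral_U01 (f : measurableTypeR R -> R) : measurable_fun setT f ->
  (\int[U]_x (f x)%:E = \int[mu]_(x in `[0%R, 1%R]) (f x)%:E)%E.
Proof.
move=> /measurable_EFinP mf.
rewrite integralE [RHS]integralE; congr (_ - _)%E.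
  rewrite integral_uniform ?subr0 ?invr1 ?mul1e//.
  exact: measurable_funepos.
rewrite integral_uniform ?subr0 ?invr1 ?mul1e//.
exact: measurable_funeneg.
Qed.

Lemma integral_U_cts (f : R -> R) : continuous f ->
  (\int[U]_x (f x)%:E = (segint f 0 1)%:E)%E.
Proof.
move=> fc; rewrite integral_U01; last exact: continuous_measurable_fun.
rewrite /segint /Rintegral fineK//.
apply: integrable_fin_num => //.
by apply: cts_segintegrable => x _; exact: fc.
Qed.

Variable n : nat.
Variable F : T n.+1 -> R.
Hypothesis Fi : (haar R n.+1).-integrable setT (EFin \o F).

Lemma haarS_integrable :
  (U \x haar R n)%E.-integrable setT (fun p => (F (tcons p.1 p.2))%:E).
Proof.
have /integrableP[mF iF] := Fi; apply/integrableP; split.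
  have := measurableT_comp mF (@measurable_cons_pair R n).
  by apply: eq_measurable_fun => -[x t] _.
apply: le_lt_trans iF; rewrite [leRHS]ge0_integral_distribution//.
exact: measurableT_comp.
Qed.

Lemma haarS_integral :
  (\int[haar R n.+1]_t (F t)%:E = \int[U \x haar R n]_p (F (tcons p.1 p.2))%:E)%E.
Proof.
have /integrableP[mF iF] := Fi.
rewrite integral_distribution//.
by apply: eq_integrable haarS_integrable => // -[x t] _.
Qed.

Lemma haarS_integral12 :
  (\int[haar R n.+1]_t (F t)%:E = \int[U]_x \int[haar R n]_t (F (tcons x t))%:E)%E.
Proof. by rewrite haarS_integral -(integral12_prod_meas1 haarS_integrable). Qed.

Lemma haarS_integral21 :
  (\int[haar R n.+1]_t (F t)%:E = \int[haar R n]_t \int[U]_x (F (tcons x t))%:E)%E.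
Proof. by rewrite haarS_integral -(integral21_prod_meas1 haarS_integrable). Qed.

(** Fubini makes a section integrable only for almost every x, so its integral is prescribed only at
    such x. The mean value formulas below can then assume integrability, and no uniform bound on
    dilates has to be derived from compactness. *)
Lemma haarS_ae_integral (V : R -> R) : measurable_fun setT V ->
  (forall x, (haar R n).-integrable setT (fun t => (F (tcons x t))%:E) ->
     \int[haar R n]_t (F (tcons x t))%:E = (V x)%:E)%E ->
  (\int[haar R n.+1]_t (F t)%:E = \int[U]_x (V x)%:E)%E.
Proof.
move=> mV FV; rewrite haarS_integral12; apply: ae_eq_integral => //.
- exact: (measurable_fubini_F haarS_integrable).
- exact/measurable_EFinP.
by apply: filterS (ae_integrable1 haarS_integrable) => x ix _; exact: FV.
Qed.

End haar_integral.

(** * Taylor coefficients of order zero and one from circle integrals *)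

Section circle_integral.
Variable R : realType.
Local Notation U := (uniform_prob (@ltr01 R)).
Implicit Types (z w be al : R[i]) (r x y e : R).

Lemma cdiff_divw (G : R[i] -> R[i]) c w0 : w0 != 0 -> cdiff G w0 ->
  cdiff (fun w => (G w - c) / w) w0.
Proof.
move=> w00 [be gd].
pose b' := (be * w0 - (G w0 - c)) / w0 ^+ 2.
exists b' => e e0.
have n0 : 0 < normc w0.
  by rewrite lt_neqAle normc_ge0 andbT; apply: contra w00 => /eqP/esym/eq0_normc ->.
have K0 : 0 < 1 + normc b' by rewrite ltr_pwDl// normc_ge0.
(* The remainder splits into two pieces, each at most [e'] times the distance to [w0]; dividing by
   w, whose modulus is at least half that of [w0], gives back [e]. *)
pose e' := e * normc w0 / 4.
have e'0 : 0 < e' by rewrite divr_gt0// mulr_gt0.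
have [del del0 H] := gd e' e'0.
exists (Num.min del (Num.min (normc w0 / 2) (e' / (1 + normc b')))).
  by rewrite !lt_min del0 (divr_gt0 n0)// (divr_gt0 e'0 K0).
move=> w; rewrite !lt_min => /and3P[/H h1 h2 h3].
have wge : normc w0 / 2 <= normc w.
  have := le_normcD (w0 - w) w; rewrite subrK normc_distC; lra.
have w0' : w != 0.
  apply/negP => /eqP w0'; move: wge; rewrite w0' normc0 => wge.
  by move: n0; rewrite ltNge; apply/negP; rewrite negbK; lra.
have -> : (G w - c) / w - (G w0 - c) / w0 - b' * (w - w0) =
    (G w - G w0 - be * (w - w0) - b' * (w - w0) * (w - w0)) / w.
  by rewrite /b'; field; rewrite w0' w00.
rewrite normcM normcV ler_pdivrMr; last by rewrite (lt_le_trans _ wge)// divr_gt0.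
have h4 : normc b' * normc (w - w0) <= e'.
  move: h3; rewrite ltr_pdivlMr// => h3; rewrite (le_trans _ (ltW h3))//.
  by rewrite mulrC ler_wpM2l ?normc_ge0// lerDr.
have nn := normc_ge0 (w - w0).
apply: (@le_trans _ _ (e' * normc (w - w0) + e' * normc (w - w0))).
  rewrite (le_trans (le_normcD _ _))// normcN (normcM (b' * _)) (normcM b') lerD//.
  by rewrite ler_wpM2r.
have -> : e' * normc (w - w0) + e' * normc (w - w0) =
  (e * normc (w - w0)) * (normc w0 / 2) by rewrite /e'; field.
by rewrite ler_wpM2l// mulr_ge0// ltW.
Qed.

Lemma cdiff_lin (g : R[i] -> R[i]) a b w0 : cdiff g w0 ->
  cdiff (fun w => a * g w + b * w) w0.
Proof.
move=> [be gd]; exists (a * be + b) => e e0.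
have K0 : 0 < 1 + normc a by rewrite ltr_pwDl// normc_ge0.
have [del del0 H] := gd _ (divr_gt0 e0 K0); exists del => // w /H h.
have -> : a * g w + b * w - (a * g w0 + b * w0) - (a * be + b) * (w - w0) =
  a * (g w - g w0 - be * (w - w0)) by ring.
rewrite normcM (le_trans (ler_wpM2l (normc_ge0 _) h))//.
rewrite mulrA ler_wpM2r ?normc_ge0// mulrCA ler_piMr ?(ltW e0)//.
by rewrite ler_pdivrMr// mul1r lerDr.
Qed.

Lemma cdiff_circle_cts (g : R[i] -> R[i]) r : 0 < r ->
  (forall w, normc w = r -> cdiff g w) ->
  continuous (fun y => complex.Re (g (r%:C * cis y))).
Proof.
move=> r0 gd y.
have [] // := @cdiff_path_cts _ g (fun y => r%:C * cis y) y (r * (4 * pi)).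
  by apply: gd; rewrite normc_polar gtr0_norm.
move=> s; rewrite -mulrBr normcM normc_real gtr0_norm// -mulrA ler_pM2l//.
exact: normc_cisB.
Qed.

Lemma integral_circle_punctured (g : R[i] -> R[i]) (L : R[i]) r : 0 < r < 1 ->
  (forall w, 0 < normc w < 1 -> cdiff g w) ->
  (forall e : R, 0 < e -> exists2 del : R, 0 < del &
     forall w, 0 < normc w < del -> normc (g w - L) <= e) ->
  (\int[U]_x (complex.Re (g (r%:C * cis x)))%:E = (complex.Re L)%:E)%E.
Proof.
move=> /[dup] r01 /andP[r0 r1] gd gL.
rewrite integral_U_cts; first by rewrite (circle_mean_punctured gd r01 gL).
by apply: cdiff_circle_cts => // w wr; apply: gd; rewrite wr r0.
Qed.

Lemma integral_circle (g : R[i] -> R[i]) r : 0 < r < 1 ->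
  (forall w, normc w < 1 -> cdiff g w) ->
  (\int[U]_x (complex.Re (g (r%:C * cis x)))%:E = (complex.Re (g 0))%:E)%E.
Proof.
move=> r01 gd; apply: integral_circle_punctured => // [w /andP[_ /gd]//|e e0].
have [|del del0 H] := cdiff_cont (gd 0 _) e0; first by rewrite normc0.
by exists del => // w /andP[_ wd]; apply/ltW/H; rewrite subr0.
Qed.

Lemma mul_cis_conj x : cis x * (cis x)^* = 1.
Proof.
rewrite /cis; apply/eqP; rewrite eq_complex /=; apply/andP; split; apply/eqP.
  by rewrite mulrN opprK -!expr2 cos2Dsin2.
by rewrite mulrN mulrC addNr.
Qed.

(** The coefficient [be] of w enters as the derivative at 0 alone. Continuity is part of the
    conclusion because the integrand later serves as the outer one in Fubini, where measurability is
    required. *)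
Lemma integral_circle_coef (G : R[i] -> R[i]) al be r : 0 < r < 1 ->
  (forall w, normc w < 1 -> cdiff G w) ->
  (forall e, 0 < e -> exists2 del : R, 0 < del & forall w, normc (w - 0) < del ->
    normc (G w - G 0 - be * (w - 0)) <= e * normc (w - 0)) ->
  continuous (fun x => complex.Re (al * (cis x)^* * G (r%:C * cis x))) /\
  (\int[U]_x (complex.Re (al * (cis x)^* * G (r%:C * cis x)))%:E =
    (complex.Re (al * r%:C * be))%:E)%E.
Proof.
move=> /[dup] r01 /andP[r0 r1] Gd G0.
(* [(cis x)^* = r / (r cis x)], so away from the constant term of G the integrand
   is a function of [r cis x]; conjugating that term makes it one as well. *)
pose b := ((al * G 0)^*)%R / r%:C.
pose g w := (al * r%:C) * ((G w - G 0) / w) + b * w.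
have rC0 : r%:C != 0 by apply/negP => /eqP[re0]; rewrite re0 ltxx in r0.
have cis_neq0 x : cis x != 0.
  by apply/negP => /eqP c0; have := mul_cis_conj x; rewrite c0 mul0r => /eqP; rewrite eq_sym oner_eq0.
have Re_conj z : complex.Re (z^*)%R = complex.Re z by case: z.
have gE x : complex.Re (al * (cis x)^* * G (r%:C * cis x)) = complex.Re (g (r%:C * cis x)).
  have -> : al * (cis x)^* * G (r%:C * cis x) =
    (al * r%:C) * ((G (r%:C * cis x) - G 0) / (r%:C * cis x)) + al * G 0 * (cis x)^*.
    have -> : ((cis x)^*)%R = (cis x)^-1.
      by rewrite -[LHS]mul1r -[X in X * _](mulVf (cis_neq0 x)) -mulrA mul_cis_conj mulr1.
    by field; rewrite rC0 cis_neq0.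
  rewrite /g !raddfD/=; congr (_ + _).
  rewrite -[LHS]Re_conj rmorphM/= conjCK /b; congr complex.Re.
  by field.
have gd w : 0 < normc w < 1 -> cdiff g w.
  move=> /andP[w0 w1]; apply: cdiff_lin; apply: cdiff_divw; last exact: Gd.
  by apply/negP => /eqP w00; rewrite w00 normc0 ltxx in w0.
split.
  rewrite (funext gE); apply: cdiff_circle_cts => // w wr.
  by apply: gd; rewrite wr r0.
under eq_integral do rewrite gE.
apply: integral_circle_punctured => //.
move=> e e0.
pose K := 1 + normc (al * r%:C) + normc b.
have K0 : 0 < K by rewrite /K -addrA ltr_pwDl// addr_ge0// normc_ge0.
have e'0 : 0 < e / K by rewrite divr_gt0.
have [del del0 H] := G0 _ e'0.
exists (Num.min del (e / K)); first by rewrite lt_min del0.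
move=> w; rewrite lt_min => /and3P[w0 w1 w2].
have wn0 : w != 0.
  by apply/negP => /eqP w00; rewrite w00 normc0 ltxx in w0.
have -> : g w - al * r%:C * be =
   (al * r%:C) * ((G w - G 0 - be * (w - 0)) / w) + b * w.
  by rewrite /g; field.
rewrite (le_trans (le_normcD _ _))// normcM [normc (b * w)]normcM.
have h1 : normc ((G w - G 0 - be * (w - 0)) / w) <= e / K.
  rewrite normcM normcV ler_pdivrMr//.
  by have := H w; rewrite subr0; apply.
have h2 := ler_wpM2l (normc_ge0 (al * r%:C)) h1.
have h3 := ler_wpM2l (normc_ge0 b) (ltW w2).
rewrite (le_trans (lerD h2 h3))// -mulrDl mulrCA ler_piMr ?(ltW e0)//.
by rewrite ler_pdivrMr// mul1r /K -addrA lerDr.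
Qed.

End circle_integral.

(** * The mean value property on the polydisc *)

Section holomorphic_tuple.
Variable R : realType.
Local Notation U := (uniform_prob (@ltr01 R)).
Local Notation T n := (n.-tuple (measurableTypeR R)).
Local Notation C n := (n.-tuple R[i]).

Definition pol r n (t : T n) : C n := map_tuple (fun x => r%:C * cis (x : R)) t.

Definition polyd n (s : C n) := forall j, normc (tnth s j) < 1.

(* Complex Frechet differentiability, with the l^1 norm on C^n. *)
Definition frech n (h : C n -> R[i]) (s : C n) := exists be : 'I_n -> R[i],
  forall e : R, 0 < e -> exists2 del : R, 0 < del & forall s' : C n,
    (forall j, normc (tnth s' j - tnth s j) < del) ->
    normc (h s' - h s - \sum_j be j * (tnth s' j - tnth s j)) <=
      e * \sum_j normc (tnth s' j - tnth s j).

Definition hol n (h : C n -> R[i]) := forall s, polyd s -> frech h s.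

Definition ctup0 n : C n := nseq_tuple n 0.

Lemma polyd_ctup0 n : polyd (ctup0 n).
Proof. by move=> j; rewrite tnth_nseq normc0. Qed.

Lemma polyd_cons n (w : R[i]) (s : C n) : normc w < 1 -> polyd s ->
  polyd (cons_tuple w s).
Proof.
move=> w1 s1 j; case: (unliftP ord0 j) => [k|] ->; last by rewrite tnth0.
by rewrite tnthS.
Qed.

Lemma polyd_pol r n (t : T n) : 0 <= r < 1 -> polyd (pol r t).
Proof. by move=> /andP[r0 r1] j; rewrite tnth_map normc_polar ger0_norm. Qed.

Lemma pol_tcons r n x (t : T n) :
  pol r (tcons x t) = cons_tuple (r%:C * cis (x : R)) (pol r t).
Proof. exact: val_inj. Qed.

Lemma ctup0S n : ctup0 n.+1 = cons_tuple 0 (ctup0 n).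
Proof. exact: val_inj. Qed.

Lemma hol_head n (h : C n.+1 -> R[i]) (s : C n) w : hol h -> polyd s ->
  normc w < 1 -> cdiff (fun w => h (cons_tuple w s)) w.
Proof.
move=> hh s1 w1; have [be H] := hh _ (polyd_cons w1 s1).
exists (be ord0) => e /H[del del0 {}H]; exists del => // w' w'd.
have := H (cons_tuple w' s); rewrite !big_ord_recl !tnth0.
rewrite !big1 ?addr0; first apply.
- by move=> j; case: (unliftP ord0 j) => [k|] ->; rewrite ?tnth0// !tnthS subrr normc0.
- by move=> j _; rewrite !tnthS subrr normc0.
- by move=> j _; rewrite !tnthS subrr mulr0.
Qed.

Lemma hol_tail n (h : C n.+1 -> R[i]) w : hol h -> normc w < 1 ->
  hol (fun s : C n => h (cons_tuple w s)).
Proof.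
move=> hh w1 s s1; have [be H] := hh _ (polyd_cons w1 s1).
exists (fun j => be (lift ord0 j)) => e /H[del del0 {}H]; exists del => // s' s'd.
have := H (cons_tuple w s'); rewrite !big_ord_recl !tnth0 subrr mulr0 normc0 !add0r.
under eq_bigr do rewrite !tnthS.
have -> : \sum_(i < n) normc (tnth (cons_tuple w s') (lift ord0 i) -
    tnth (cons_tuple w s) (lift ord0 i)) = \sum_j normc (tnth s' j - tnth s j).
  by apply: eq_bigr => j _; rewrite !tnthS.
apply=> j; case: (unliftP ord0 j) => [k|] ->; first by rewrite !tnthS.
by rewrite !tnth0 subrr normc0.
Qed.

Lemma holZ n (h : C n -> R[i]) c : hol h -> hol (fun s => c * h s).
Proof.
move=> hh s /hh[be H]; exists (fun j => c * be j) => e e0.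
have K0 : 0 < 1 + normc c by rewrite ltr_pwDl// normc_ge0.
have [del del0 {}H] := H _ (divr_gt0 e0 K0); exists del => // s' /H h1.
have -> : c * h s' - c * h s - \sum_j c * be j * (tnth s' j - tnth s j) =
  c * (h s' - h s - \sum_j be j * (tnth s' j - tnth s j)).
  by rewrite 2!mulrBr mulr_sumr; congr (_ - _); apply: eq_bigr => j _; rewrite mulrA.
rewrite normcM (le_trans (ler_wpM2l (normc_ge0 _) h1))//.
rewrite mulrA ler_wpM2r ?sumr_ge0//; first by move=> j _; exact: normc_ge0.
by rewrite mulrCA ler_piMr ?(ltW e0)// ler_pdivrMr// mul1r lerDr.
Qed.

Lemma normc_sum (I : finType) (f : I -> R[i]) :
  normc (\sum_i f i) <= \sum_i normc (f i).
Proof.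
elim/big_ind2 : _ => //; first by rewrite normc0.
by move=> x1 x2 y1 y2 h1 h2; rewrite (le_trans (le_normcD _ _))// lerD.
Qed.

Lemma frech_cts n (h : C n -> R[i]) s : frech h s -> forall e : R, 0 < e ->
  exists2 del : R, 0 < del & forall s' : C n,
    (forall j, normc (tnth s' j - tnth s j) < del) -> normc (h s' - h s) < e.
Proof.
move=> [be H] e e0; have [d1 d10 {}H] := H 1 ltr01.
pose K := 1 + \sum_j (1 + normc (be j)).
have K0 : 0 < K by rewrite ltr_pwDl// sumr_ge0// => j _; rewrite addr_ge0// normc_ge0.
exists (Num.min d1 (e / K)); first by rewrite lt_min d10 divr_gt0.
move=> s' s'd.
have h1 : normc (h s' - h s - \sum_j be j * (tnth s' j - tnth s j)) <=
    1 * \sum_j normc (tnth s' j - tnth s j).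
  by apply: H => j; rewrite (lt_le_trans (s'd j))// ge_min lexx.
have h2 j : normc (tnth s' j - tnth s j) <= e / K.
  by rewrite ltW// (lt_le_trans (s'd j))// ge_min lexx orbT.
rewrite -[X in normc X](subrK (\sum_j be j * (tnth s' j - tnth s j))).
rewrite (le_lt_trans (le_normcD _ _))//.
rewrite (@le_lt_trans _ _ (\sum_j (1 + normc (be j)) * (e / K)))//.
  rewrite mul1r in h1; rewrite (le_trans (lerD h1 (normc_sum _)))//.
  rewrite -big_split/=; apply: ler_sum => j _.
  rewrite normcM mulrDl mul1r lerD ?h2// ler_wpM2l ?normc_ge0//.
rewrite -mulr_suml mulrCA gtr_pMr// ltr_pdivrMr// mul1r /K ltrDr//.
Qed.

Lemma hol_measurable n (h : C n -> R[i]) r : hol h -> 0 <= r < 1 ->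
  measurable_fun setT (fun t : T n => complex.Re (h (pol r t)) : R) /\
  measurable_fun setT (fun t : T n => complex.Im (h (pol r t)) : R).
Proof.
move=> hh /[dup] r01 /andP[r0 r1].
have key (g : C n -> R[i]) : hol g -> tuple_cts (fun t : T n => complex.Re (g (pol r t))).
  move=> gh t e e0.
  have [del del0 H] := frech_cts (gh _ (polyd_pol t r01)) e0.
  have pi0 : 0 < pi :> R := pi_gt0 R.
  have p4 : 0 < 4 * pi :> R by rewrite mulr_gt0.
  exists (del / (4 * pi)); first by rewrite divr_gt0.
  move=> t' t'd.
  have : normc (g (pol r t') - g (pol r t)) < e.
    apply: H => j; rewrite !tnth_map -mulrBr normcM normc_real ger0_norm//.
    have := t'd j; rewrite ltr_pdivlMr// mulrC; apply: le_lt_trans.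
    rewrite (le_trans _ (normc_cisB _ _))// ler_piMl ?normc_ge0// ltW//.
  apply: le_lt_trans; have [] := normc_ge_ReIm (g (pol r t') - g (pol r t)).
  by case: (g _) (g _) => ? ? [].
split; first by apply: tuple_cts_measurable; exact: key.
apply: tuple_cts_measurable.
(* The imaginary part of h is the real part of [- 'i * h]. *)
have := key _ (holZ (- 'i) hh); rewrite (_ : (fun t => _) = fun t => complex.Im (h (pol r t)))//.
by apply/funext => t; case: (h _) => a b /=; ring.
Qed.

(** The mean value property in n variables is a hypothesis, so that the lemma serves inside the
    induction proving [haar_mean] and again once that is proved. [H x] may depend on the head in a
    non-holomorphic way, which admits conjugated weights. *)
Lemma haar_mean_tail n (H : R -> C n -> R[i]) (V : R -> R) (F : T n.+1 -> R) r :
  (forall h : C n -> R[i], hol h ->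
    (haar R n).-integrable setT (fun t => (complex.Re (h (pol r t)))%:E) ->
    \int[haar R n]_t (complex.Re (h (pol r t)))%:E = (complex.Re (h (ctup0 n)))%:E)%E ->
  (forall x, hol (H x)) -> measurable_fun setT V ->
  (forall x t, F (tcons x t) = complex.Re (H x (pol r t))) ->
  (forall x, V x = complex.Re (H x (ctup0 n))) ->
  (haar R n.+1).-integrable setT (EFin \o F) ->
  (\int[haar R n.+1]_t (F t)%:E = \int[U]_x (V x)%:E)%E.
Proof.
move=> mean Hh mV FE VE Fi; apply: haarS_ae_integral => // x.
rewrite (_ : (fun t => _) = fun t => (complex.Re (H x (pol r t)))%:E); last first.
  by apply/funext => t; rewrite FE.
by move=> ix; rewrite VE; exact: mean (Hh x) ix.
Qed.

Lemma haar_mean n (h : C n -> R[i]) r : 0 < r < 1 -> hol h ->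
  (haar R n).-integrable setT (fun t => (complex.Re (h (pol r t)))%:E) ->
  (\int[haar R n]_t (complex.Re (h (pol r t)))%:E = (complex.Re (h (ctup0 n)))%:E)%E.
Proof.
move=> r01; have [r0 r1] := andP r01; elim: n h => [|n IH] h hh hi.
  rewrite /= integral_dirac//; last first.
    by have /integrableP[] := hi.
  by rewrite diracT mul1e (tuple0 (pol _ _)) (tuple0 (ctup0 _)).
have r01' : 0 <= r < 1 by rewrite ltW.
have nr x : normc (r%:C * cis x) < 1 by rewrite normc_polar gtr0_norm.
pose g w := h (cons_tuple w (ctup0 n)).
have gd w : normc w < 1 -> cdiff g w by move=> w1; apply: hol_head => //; exact: polyd_ctup0.
rewrite (@haar_mean_tail n (fun x s => h (cons_tuple (r%:C * cis x) s))
  (fun x => complex.Re (g (r%:C * cis x))) _ r).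
- by rewrite integral_circle// /g ctup0S.
- by [].
- by move=> x; exact: hol_tail.
- apply: continuous_measurable_fun; apply: cdiff_circle_cts => // w wr.
  by apply: gd; rewrite wr.
- by move=> x t; rewrite pol_tcons.
- by [].
- by [].
Qed.

(** The head is integrated first; the dependence of [G] on the tail is then arbitrary, since every
    inner integral is already zero. *)
Lemma haar_mean_head n (G : T n -> R[i] -> R[i]) (F : T n.+1 -> R) r : 0 < r < 1 ->
  (forall t w, normc w < 1 -> cdiff (G t) w) -> (forall t, G t 0 = 0) ->
  (forall x t, F (tcons x t) = complex.Re (G t (r%:C * cis (x : R)))) ->
  (haar R n.+1).-integrable setT (EFin \o F) ->
  (\int[haar R n.+1]_t (F t)%:E = 0)%E.
Proof.
move=> r01 Gd G0 FE Fi; rewrite haarS_integral21// integral0_eq// => t _.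
under eq_integral do rewrite FE.
by rewrite integral_circle// ?G0//; exact: Gd.
Qed.

End holomorphic_tuple.

(** * From differentiability on row vectors to estimates on moduli *)

Section row_tuple.
Variables (R : realType) (n : nat).
Local Notation T := (n.-tuple (measurableTypeR R)).

Definition row_of (s : n.-tuple R[i]) : 'rV[cplx R]_n := \row_j (tnth s j : cplx R).

Lemma dilate_pol r (f : 'rV[cplx R]_n -> cplx R) (t : T) :
  dilate r f t = f (row_of (pol r t)).
Proof. by congr f; apply/rowP => j; rewrite !mxE tnth_map. Qed.

Lemma polydisc_row_of s : polyd s -> polydisc (row_of s).
Proof. by move=> s1 j; rewrite mxE. Qed.

Lemma normC_normc (z : cplx R) : `|z| = (normc z)%:C.
Proof. by []. Qed.

Lemma mx_norm_le_sum (v : 'rV[cplx R]_n) : `|v| <= (\sum_j normc (v 0 j))%:C.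
Proof.
have [->|v0] := eqVneq `|v| 0.
  by rewrite lecR sumr_ge0// => j _; exact: normc_ge0.
have [[i j] vij] := mx_norm_neq0 v0.
rewrite [leLHS]vij /= normC_normc lecR (bigD1 j)//= (ord1 i) lerDl.
by rewrite sumr_ge0// => k _; exact: normc_ge0.
Qed.

(** The coefficients are the values of the differential on the canonical basis, and the norm in
    which the remainder is small is dominated by the l^1 norm. *)
Lemma differentiable_hol (f : 'rV[cplx R]_n -> cplx R) :
  (forall z, polydisc z -> differentiable f z) -> hol (fun s => f (row_of s)).
Proof.
move=> df s s1; have fd := df _ (polydisc_row_of s1).
exists (fun j => 'd f (row_of s) 'e_j) => e e0.
have := diff_locally fd; move/eqaddoP => /(_ e%:C).
rewrite ltcR => /(_ e0)/nbhs_ballP[d /= d0 H].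
(* The radius of the ball is an element of [cplx R]; its positivity forces it to be real. *)
have [dR dR0 dE] : exists2 dR : R, 0 < dR & d = dR%:C.
  case: d d0 {H} => a b; rewrite ltcE/= => /andP[/eqP -> a0].
  by exists a.
exists dR => // s' s'd.
have := H (row_of s' - row_of s).
have hb : ball 0 d (row_of s' - row_of s).
  split=> // i j; rewrite (ord1 i) !mxE /ball/= sub0r normrN normC_normc dE ltcR.
  exact: s'd.
move=> /(_ hb); rewrite /= !fctE/= subrK => h.
rewrite -lecR; apply: (le_trans _ (le_trans h _)); last first.
  rewrite rmorphM/= ler_wpM2l ?lecR ?(ltW e0)//.
  apply: (le_trans (mx_norm_le_sum _)); rewrite lecR.
  by apply: ler_sum => j _; rewrite !mxE.
rewrite -normC_normc le_eqVlt; apply/orP; left; apply/eqP; congr `|_|.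
rewrite opprD addrA; congr (_ - _).
rewrite [in RHS](row_sum_delta (row_of s' - row_of s)) linear_sum/=.
by apply: eq_bigr => j _; rewrite linearZ/= !mxE mulrC.
Qed.

End row_tuple.

(** * Mean squares over the torus *)

Section mean_square.
Variables (R : realType) (n : nat).
Local Notation T := (n.-tuple (measurableTypeR R)).
Local Notation mu := (haar R n).
Implicit Types (F G : T -> R[i]).

Lemma cvge0_at_left1 (phi : R -> \bar R) : (forall r, 0 <= phi r)%E ->
  (phi r @[r --> 1^'-] --> 0%E) <->
  (forall e : R, 0 < e -> \forall r \near 1^'-, (phi r <= e%:E)%E).
Proof.
move=> phi0; split=> [H e e0|H].
  have : nbhs (0%E : \bar R) [set x : \bar R | (x <= e%:E)%E].
    change (nbhs (0 : R) (fun x : R => (x%:E <= e%:E)%E)).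
    apply/nbhs_ballP; exists e => //= x; rewrite /ball/= sub0r => xe.
    by rewrite /= lee_fin (le_trans (ler_norm _))// -normrN ltW.
  exact: H.
move=> A HA; have : nbhs (0 : R) (fun x : R => A x%:E) by [].
move=> /nbhs_ballP[e /= e0 eA].
have := H (e / 2) (divr_gt0 e0 (ltr0Sn _ 1)); apply: filterS => r re.
suff : A (phi r) by []; have := phi0 r; move: re; case: (phi r) => [x| |]//.
rewrite !lee_fin => xe x0; apply: eA; rewrite /ball/= sub0r normrN ger0_norm//.
by rewrite (le_lt_trans xe)// ltr_pdivrMr// mulr_natr mulr2n ltrDl.
Qed.

Definition measurable_cplx F :=
  measurable_fun setT (fun t => complex.Re (F t) : R) /\
  measurable_fun setT (fun t => complex.Im (F t) : R).

Definition msq F := (\int[mu]_t (normc (F t) ^+ 2)%:E)%E.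

Lemma normc_sq (z : R[i]) : normc z ^+ 2 = complex.Re z ^+ 2 + complex.Im z ^+ 2.
Proof. by case: z => a b /=; rewrite sqr_sqrtr// addr_ge0// sqr_ge0. Qed.

Lemma measurable_cplxD F G : measurable_cplx F -> measurable_cplx G ->
  measurable_cplx (fun t => F t + G t).
Proof.
move=> [F1 F2] [G1 G2]; split.
  by have := measurable_funD F1 G1; apply: eq_measurable_fun => t _ /=; case: (F t) (G t) => a b [c d].
by have := measurable_funD F2 G2; apply: eq_measurable_fun => t _ /=; case: (F t) (G t) => a b [c d].
Qed.

Lemma measurable_cplxM F G : measurable_cplx F -> measurable_cplx G ->
  measurable_cplx (fun t => F t * G t).
Proof.
move=> [F1 F2] [G1 G2]; split.
  have := measurable_funB (measurable_funM F1 G1) (measurable_funM F2 G2).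
  by apply: eq_measurable_fun => t _ /=; case: (F t) (G t) => a b [c d].
have := measurable_funD (measurable_funM F1 G2) (measurable_funM F2 G1).
by apply: eq_measurable_fun => t _ /=; case: (F t) (G t) => a b [c d].
Qed.

Lemma measurable_cplx_cst c : measurable_cplx (fun=> c).
Proof. by split; exact: measurable_cst. Qed.

Lemma measurable_cplxB F G : measurable_cplx F -> measurable_cplx G ->
  measurable_cplx (fun t => F t - G t).
Proof.
move=> mF mG.
have := measurable_cplxD mF (measurable_cplxM (measurable_cplx_cst (-1)) mG).
by under eq_fun do rewrite mulN1r.
Qed.

Lemma measurable_cplx_conj F : measurable_cplx F ->
  measurable_cplx (fun t => (F t)^*%R).
Proof.
move=> [F1 F2]; split.
  by apply: eq_measurable_fun F1 => t _; case: (F t).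
have := measurable_funB (@measurable_cst _ _ _ _ _ (0 : R)) F2.
by apply: eq_measurable_fun => t _; rewrite /= sub0r; case: (F t).
Qed.

Lemma measurable_normc_sq F : measurable_cplx F ->
  measurable_fun setT (fun t => (normc (F t) ^+ 2)%:E).
Proof.
move=> [F1 F2]; apply/measurable_EFinP.
have := measurable_funD (measurable_funM F1 F1) (measurable_funM F2 F2).
by apply: eq_measurable_fun => t _; rewrite /= normc_sq !expr2.
Qed.

Lemma measurable_normc F : measurable_cplx F ->
  measurable_fun setT (fun t => normc (F t)).
Proof.
move=> [F1 F2].
have := measurableT_comp (continuous_measurable_fun (@sqrt_continuous R))
  (measurable_funD (measurable_funM F1 F1) (measurable_funM F2 F2)).
by apply: eq_measurable_fun => t _ /=; case: (F t) => a b /=; rewrite !expr2.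
Qed.

Lemma msq_ge0 F : (0 <= msq F)%E.
Proof. by apply: integral_ge0 => t _; rewrite lee_fin sqr_ge0. Qed.

Lemma eq_msq F G : F =1 G -> msq F = msq G.
Proof. by move=> FG; apply: eq_integral => t _; rewrite FG. Qed.

Lemma msq_le F G (K : R) : measurable_cplx F -> measurable_cplx G -> 0 <= K ->
  (forall t, normc (F t) <= K * normc (G t)) ->
  (msq F <= (K ^+ 2)%:E * msq G)%E.
Proof.
move=> mF mG K0 FG; rewrite /msq -ge0_integralZl//.
- apply: ge0_le_integral => //.
  + by move=> t _; rewrite lee_fin sqr_ge0.
  + exact: measurable_normc_sq.
  + by apply: emeasurable_funM => //; exact: measurable_normc_sq.
  + move=> t _; rewrite -EFinM lee_fin -exprMn.
    by rewrite ler_pXn2r ?nnegrE ?normc_ge0// mulr_ge0// normc_ge0.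
- exact: measurable_normc_sq.
- by move=> t _; rewrite lee_fin sqr_ge0.
- by rewrite lee_fin sqr_ge0.
Qed.

(** A pointwise bound stands in for Minkowski's inequality: the factors 2 are harmless in limits,
    and no square root of an extended real is taken. *)
Lemma msqD F G : measurable_cplx F -> measurable_cplx G ->
  (msq (fun t => F t + G t)%R <= 2%:E * msq F + 2%:E * msq G)%E.
Proof.
move=> mF mG; have nsq0 (H : T -> R[i]) t : setT t -> (0 <= (normc (H t) ^+ 2)%:E)%E.
  by rewrite lee_fin sqr_ge0.
rewrite /msq -!ge0_integralZl//; try exact: measurable_normc_sq;
  try exact: nsq0.
rewrite -ge0_integralD//.
- apply: ge0_le_integral => //.
  + by move=> t _; rewrite lee_fin sqr_ge0.
  + by apply: measurable_normc_sq; exact: measurable_cplxD.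
  + by apply: emeasurable_funD; apply: emeasurable_funM => //; exact: measurable_normc_sq.
  + move=> t _; rewrite -!EFinM -EFinD lee_fin.
    apply: (@le_trans _ _ ((normc (F t) + normc (G t)) ^+ 2)).
      by rewrite ler_pXn2r ?nnegrE ?addr_ge0 ?normc_ge0// le_normcD.
    have := sqr_ge0 (normc (F t) - normc (G t)); nra.
- by move=> t _; rewrite -EFinM lee_fin mulr_ge0// sqr_ge0.
- by apply: emeasurable_funM => //; exact: measurable_normc_sq.
- by move=> t _; rewrite -EFinM lee_fin mulr_ge0// sqr_ge0.
- by apply: emeasurable_funM => //; exact: measurable_normc_sq.
Qed.

Lemma msq_eq0 F : measurable_cplx F -> msq F = 0%E ->
  \forall t \ae mu, F t = 0.
Proof.
move=> mF /eqP; rewrite /msq => /eqP F0.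
have /ae_eq_integral_abs : (\int[mu]_t `|(normc (F t) ^+ 2)%:E| = 0)%E.
  by rewrite -[RHS]F0; apply: eq_integral => t _; rewrite gee0_abs// lee_fin sqr_ge0.
move=> /(_ measurableT (measurable_normc_sq mF)); apply: filterS => t /(_ I)[].
by move=> /eqP; rewrite sqrf_eq0 => /eqP/eq0_normc.
Qed.

(** A substitute for Cauchy-Schwarz: with [d] fixed and small, a much smaller mean square makes the
    mean small. Optimizing [d] would recover the inequality up to a factor 2. *)
Lemma mean_le_msq F (d : R) : 0 < d -> measurable_cplx F ->
  (\int[mu]_t (normc (F t))%:E <= d%:E + d^-1%:E * msq F)%E.
Proof.
move=> d0 mF; have -> : d%:E = (\int[mu]_t d%:E)%E.
  by rewrite integral_cst//= probability_setT mule1.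
have d10 : 0 <= d^-1 by rewrite invr_ge0 ltW.
have nsq0 (H : T -> R[i]) t : setT t -> (0 <= (normc (H t) ^+ 2)%:E)%E.
  by rewrite lee_fin sqr_ge0.
rewrite /msq -ge0_integralZl//; try exact: measurable_normc_sq;
  try exact: nsq0.
rewrite -ge0_integralD//.
- apply: ge0_le_integral => //.
  + by move=> t _; rewrite lee_fin normc_ge0.
  + by apply/measurable_EFinP; exact: measurable_normc.
  + by apply: emeasurable_funD => //; apply: emeasurable_funM => //; exact: measurable_normc_sq.
  + move=> t _; rewrite -EFinM -EFinD lee_fin.
    (* [x <= d + x^2 / d] by AM-GM *)
    rewrite -(ler_pM2r d0) mulrDl mulrAC mulVf ?gt_eqF// mul1r.
    have := sqr_ge0 (normc (F t) - d / 2); nra.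
- by move=> t _; rewrite lee_fin ltW.
- by move=> t _; rewrite -EFinM lee_fin mulr_ge0// sqr_ge0.
- by apply: emeasurable_funM => //; exact: measurable_normc_sq.
Qed.

End mean_square.

(** * Functions that are radially Lipschitz up to the torus *)

Section radially_lipschitz.
Variables (R : realType) (n : nat).
Local Notation T := (n.-tuple (measurableTypeR R)).
Local Notation V := ('rV[cplx R]_n).
Implicit Types (p q : V -> cplx R) (t : T) (r : R).

(** A class of multipliers whose boundary value is their restriction to the torus. It contains the
    polynomials and the two kernels, and both bounds are uniform in [t], so that multiplication
    respects mean square limits. *)
Definition radlip p := (forall z, polydisc z -> differentiable p z) /\
  exists2 K : R, 0 <= K & forall r t, 0 < r <= 1 ->
    normc (p (r%:C *: torus_point t)) <= K /\
    normc (p (r%:C *: torus_point t) - p (torus_point t)) <= K * (1 - r).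

Lemma scale1_torus t : (1%:C : cplx R) *: torus_point t = torus_point t.
Proof. exact: scale1r. Qed.

Lemma polydisc_dilate r t : 0 < r < 1 -> polydisc ((r%:C : cplx R) *: torus_point t).
Proof. by move=> /andP[r0 r1] j; rewrite !mxE normc_polar gtr0_norm. Qed.

Lemma radlip_cst (c : cplx R) : radlip (fun=> c).
Proof.
split; first by move=> z _; exact: differentiable_cst.
exists (normc c); first exact: normc_ge0.
move=> r t /andP[r0 r1]; split=> //.
by rewrite subrr normc0 mulr_ge0 ?normc_ge0// subr_ge0.
Qed.

Lemma radlip_coord j : radlip (fun z : V => z ord0 j).
Proof.
split; first by move=> z _; exact: differentiable_coord.
exists 1 => // r t /andP[r0 r1]; rewrite !mxE normc_polar gtr0_norm//; split=> //.
have -> : r%:C * cis (tnth t j : R) - cis (tnth t j : R) = (r - 1)%:C * cis (tnth t j : R).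
  by rewrite rmorphB/= rmorph1 mulrBl mul1r.
by rewrite normc_polar mul1r distrC ger0_norm// subr_ge0.
Qed.

Lemma radlipD p q : radlip p -> radlip q -> radlip (fun z => p z + q z).
Proof.
move=> [dp [K K0 pK]] [dq [L L0 qL]]; split.
  by move=> z z1; apply: differentiableD; [exact: dp|exact: dq].
exists (K + L); first exact: addr_ge0.
move=> r t r01; have [p1 p2] := pK r t r01; have [q1 q2] := qL r t r01; split.
  by rewrite (le_trans (le_normcD _ _))// lerD.
by rewrite opprD addrACA mulrDl (le_trans (le_normcD _ _))// lerD.
Qed.

Lemma radlipM p q : radlip p -> radlip q -> radlip (fun z => p z * q z).
Proof.
move=> [dp [K K0 pK]] [dq [L L0 qL]]; split.
  by move=> z z1; apply: (differentiableM (dp _ z1) (dq _ z1)).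
(* One constant has to serve as a bound, for which [K * L] is enough, and as a Lipschitz constant,
   for which the product rule gives twice that. *)
exists (K * L + K * L); first by rewrite addr_ge0// mulr_ge0.
move=> r t r01; have [p1 p2] := pK r t r01; have [q1 q2] := qL r t r01.
have [p3 _] := pK 1 t ltac:(by rewrite ltr01 lexx).
rewrite scale1_torus in p3.
split.
  rewrite normcM (@le_trans _ _ (K * L))//; last by rewrite lerDl mulr_ge0.
  by rewrite ler_pM// normc_ge0.
set x := p _ in p1 p2 *; set y := q _ in q1 q2 *.
set x1 := p _ in p2 p3 *; set y1 := q _ in q2 *.
have -> : x * y - x1 * y1 = (x - x1) * y + x1 * (y - y1) by ring.
rewrite (le_trans (le_normcD _ _))// !normcM mulrDl lerD//.
  by rewrite mulrAC ler_pM// ?normc_ge0// mulr_ge0.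
by rewrite -mulrA ler_pM// normc_ge0.
Qed.

Lemma radlipV p (m : R) : 0 < m -> radlip p -> (forall z, polydisc z -> p z != 0) ->
  (forall r t, 0 < r <= 1 -> m <= normc (p (r%:C *: torus_point t))) ->
  radlip (fun z => (p z)^-1).
Proof.
move=> m0 [dp [K K0 pK]] p0 pm; split.
  by move=> z z1; apply: (differentiableV (dp _ z1)); exact: p0.
have pn r t : 0 < r <= 1 -> p (r%:C *: torus_point t) != 0.
  move=> r01; have h := pm r t r01; apply/negP => /eqP h0; move: h; rewrite h0 normc0.
  by rewrite leNgt m0.
exists (Num.max m^-1 (K / (m * m))); first by rewrite le_max invr_ge0 ltW.
move=> r t r01; have [p1 p2] := pK r t r01.
have m1 := pm r t r01; have n1 := pn r t r01.
have m2 := pm 1 t ltac:(by rewrite ltr01 lexx).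
have n2 := pn 1 t ltac:(by rewrite ltr01 lexx).
rewrite scale1_torus in m2 n2; split.
  rewrite normcV le_max; apply/orP; left.
  by rewrite lef_pV2 ?posrE// (lt_le_trans m0).
set x := p _ in p1 p2 m1 n1 *; set x1 := p _ in p2 m2 n2 *.
have -> : x^-1 - x1^-1 = (x1 - x) / (x * x1) by field; rewrite n1 n2.
rewrite (@le_trans _ _ (K / (m * m) * (1 - r)))//.
  rewrite normcM normcV normcM normc_distC mulrAC ler_pM//.
  - exact: normc_ge0.
  - by rewrite invr_ge0 mulr_ge0 ?normc_ge0.
  - rewrite lef_pV2 ?posrE ?mulr_gt0// ?(lt_le_trans m0)//.
    by rewrite ler_pM// ltW.
rewrite ler_wpM2r ?subr_ge0; last by rewrite le_max lexx orbT.
  by [].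
by case/andP: r01.
Qed.

Lemma dilate_measurable p r : (forall z, polydisc z -> differentiable p z) ->
  0 < r < 1 -> measurable_cplx (dilate r p : T -> R[i]).
Proof.
move=> dp /andP[r0 r1].
have [] := @hol_measurable R n _ r (differentiable_hol dp) ltac:(by rewrite ltW).
by move=> h1 h2; split; [apply: eq_measurable_fun h1|apply: eq_measurable_fun h2];
  move=> t _; rewrite dilate_pol.
Qed.

Lemma radlip_torus_measurable p : radlip p ->
  measurable_cplx (fun t : T => p (torus_point t) : R[i]).
Proof.
move=> [dp [K K0 pK]].
(* With [N.+1] the first radius would be 0, outside the range of [dilate_measurable]. *)
pose rr (N : nat) : R := 1 - N.+2%:R^-1.
have rr01 N : 0 < rr N < 1.
  rewrite /rr subr_gt0 ltrBlDr ltrDl invr_gt0 ltr0n andbT.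
  by rewrite invf_lt1 ?ltr0n// ltr1n.
have cvg_rr t (e : R) : 0 < e ->
    \forall N \near \oo, normc (p (torus_point t) - dilate (rr N) p t) < e.
  move=> e0; have e'0 : 0 < e / (K + 1) by rewrite divr_gt0// ltr_wpDl.
  have := near_infty_natSinv_lt (PosNum e'0).
  apply: filterS => N /= hN; rewrite normc_distC.
  have [|_ ] := pK (rr N) t; first by have /andP[-> /ltW] := rr01 N.
  move=> /le_lt_trans; apply; rewrite /rr opprB addrC subrK.
  move: hN; rewrite ltr_pdivlMr ?ltr_wpDl// => hN.
  apply: le_lt_trans hN; rewrite mulrC ler_pM//.
    by rewrite lef_pV2 ?posrE ?ltr0n// ler_nat.
  by rewrite lerDl.
have mr N := dilate_measurable dp (rr01 N).
split.
  apply: (@measurable_fun_cvg _ _ _ _ (fun N t => complex.Re (dilate (rr N) p t) : R)).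
    by move=> N; have [] := mr N.
  move=> t _; apply/cvgrPdist_lt => e /(cvg_rr t); apply: filterS => N.
  apply: le_lt_trans; have [h _] := normc_ge_ReIm (p (torus_point t) - dilate (rr N) p t : R[i]).
  by apply: le_trans h; case: (p _) (dilate _ _ _) => ? ? [].
apply: (@measurable_fun_cvg _ _ _ _ (fun N t => complex.Im (dilate (rr N) p t) : R)).
  by move=> N; have [] := mr N.
move=> t _; apply/cvgrPdist_lt => e /(cvg_rr t); apply: filterS => N.
apply: le_lt_trans; have [_ h] := normc_ge_ReIm (p (torus_point t) - dilate (rr N) p t : R[i]).
by apply: le_trans h; case: (p _) (dilate _ _ _) => ? ? [].
Qed.

End radially_lipschitz.

(** * Boundary values in mean square *)

Section boundary_values.
Variables (R : realType) (n : nat).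
Local Notation T := (n.-tuple (measurableTypeR R)).
Local Notation V := ('rV[cplx R]_n).
Local Notation mu := (haar R n).
Implicit Types (f g p q : V -> cplx R) (F : T -> cplx R) (t : T) (r : R).

Local Notation holo f := (forall z, polydisc z -> differentiable f z).

Lemma is_boundary_valueP f F : is_boundary_value f F <->
  [/\ measurable_cplx F, (msq F < +oo)%E & forall e : R, 0 < e ->
    \forall r \near 1^'-, (msq (fun t => (dilate r f t - F t)%R) <= e%:E)%E].
Proof.
have P := cvge0_at_left1 (phi := fun r => msq (fun t => dilate r f t - F t))
   (fun r => msq_ge0 _).
split; first by move=> [F1 F2 F3 /P F4].
by move=> [[F1 F2] F3 F4]; split=> //; apply/P.
Qed.

Lemma near_left1 : \forall r \near (1:R)^'-, 0 < r < 1.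
Proof.
have h1 := @nbhs_left_lt R 1; have h2 := @nbhs_left_gt R 1 0 ltr01.
by apply: filterS2 h2 h1 => r -> ->.
Qed.

Lemma is_boundary_value_ext f g F : (forall z, polydisc z -> f z = g z) ->
  is_boundary_value f F -> is_boundary_value g F.
Proof.
move=> fg /is_boundary_valueP[F1 F2 F3]; apply/is_boundary_valueP; split=> // e e0.
apply: filterS2 near_left1 (F3 e e0) => r r01.
by rewrite (@eq_msq _ _ _ (fun t => dilate r g t - F t))// => t;
  rewrite /dilate fg//; exact: polydisc_dilate.
Qed.

Lemma is_boundary_value1 :
  is_boundary_value ((fun=> 1) : V -> cplx R) ((fun=> 1) : T -> cplx R).
Proof.
apply/is_boundary_valueP; split; first exact: measurable_cplx_cst.
  rewrite /msq (eq_integral (fun=> 1%:E)); last by move=> t _; rewrite normc1 expr1n.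
  by rewrite integral_cst//= probability_setT mule1 ltry.
move=> e e0; apply: nearW => r; rewrite /msq (eq_integral (fun=> 0%:E)).
  by rewrite integral0 lee_fin ltW.
by move=> t _; rewrite subrr normc0 expr0n.
Qed.

(** At radius r the difference is p_r (f_r - F) + (p_r - p) F: a bounded factor times a small one,
    plus a factor of size K (1 - r) times a fixed square integrable function. *)
Lemma is_boundary_valueM p f F : radlip p -> holo f -> is_boundary_value f F ->
  is_boundary_value (fun z => p z * f z) (fun t => p (torus_point t) * F t).
Proof.
move=> /[dup] rp [dp [K K0 pK]] df /is_boundary_valueP[mF F2 F3].
have mp := radlip_torus_measurable rp.
apply/is_boundary_valueP; split; first exact: measurable_cplxM.
  have h : (msq (fun t => p (torus_point t) * F t)%R <= (K ^+ 2)%:E * msq F)%E.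
    apply: msq_le => //; first exact: measurable_cplxM.
    move=> t; rewrite normcM ler_wpM2r ?normc_ge0//.
    have [+ _] := pK 1 t ltac:(by rewrite ltr01 lexx).
    by rewrite scale1_torus.
  apply: le_lt_trans h _; rewrite lte_mul_pinfty// ?lee_fin ?sqr_ge0//.
have Ff : msq F \is a fin_num by rewrite ge0_fin_numE// msq_ge0.
pose M := fine (msq F).
have M0 : 0 <= M by rewrite fine_ge0// msq_ge0.
have FM : msq F = M%:E by rewrite fineK.
move=> e e0.
(* [A] and, below, [B] absorb the factor 2 of [msqD], so that each piece is at most [e / 2]; the
   added 1 keeps the divisors positive. *)
pose A := 2 * K ^+ 2 + 1.
have A0 : 0 < A by rewrite ltr_wpDl// mulr_ge0// sqr_ge0.
have e1 : 0 < e / (2 * A) by rewrite divr_gt0// mulr_gt0.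
pose B := 2 * K ^+ 2 * M + 1.
have B0 : 0 < B by rewrite ltr_wpDl// !mulr_ge0// sqr_ge0.
have e2 : 0 < e / (2 * B) by rewrite divr_gt0// mulr_gt0.
have nr := nbhs_left_ltBl 1 e2.
apply: filterS3 near_left1 nr (F3 _ e1) => r r01 rB fF.
have [r0 r1] := andP r01.
have r01' : 0 < r <= 1 by rewrite r0 ltW.
have mf := dilate_measurable df r01; have mpr := dilate_measurable dp r01.
have s1 : (msq (fun t => dilate r p t * (dilate r f t - F t))%R <=
    (K ^+ 2)%:E * (e / (2 * A))%:E)%E.
  apply: (@le_trans _ _ ((K ^+ 2)%:E * msq (fun t => (dilate r f t - F t)%R))%E).
    apply: msq_le => //; [|exact: measurable_cplxB|].
      by apply: measurable_cplxM => //; exact: measurable_cplxB.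
    move=> t; rewrite normcM ler_wpM2r ?normc_ge0//.
    by have [] := pK r t r01'.
  by rewrite lee_wpmul2l// lee_fin sqr_ge0.
have s2 : (msq (fun t => (dilate r p t - p (torus_point t)) * F t)%R <=
    ((K * (1 - r)) ^+ 2)%:E * M%:E)%E.
  rewrite -FM; apply: msq_le => //.
  - by apply: measurable_cplxM => //; exact: measurable_cplxB.
  - by rewrite mulr_ge0// subr_ge0 ltW.
  - by move=> t; rewrite normcM ler_wpM2r ?normc_ge0//; have [] := pK r t r01'.
rewrite (@eq_msq _ _ _ (fun t => dilate r p t * (dilate r f t - F t) +
   (dilate r p t - p (torus_point t)) * F t)); last first.
  by move=> t; rewrite /dilate; ring.
apply: (@le_trans _ _ (2%:E * ((K ^+ 2)%:E * (e / (2 * A))%:E) +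
   2%:E * (((K * (1 - r)) ^+ 2)%:E * M%:E))%E).
  apply: le_trans (msqD _ _) _.
  - by apply: measurable_cplxM => //; exact: measurable_cplxB.
  - by apply: measurable_cplxM => //; exact: measurable_cplxB.
  - by apply: leeD; rewrite lee_wpmul2l.
rewrite -!EFinM -EFinD lee_fin.
have t1 : 2 * (K ^+ 2 * (e / (2 * A))) <= e / 2.
  have -> : 2 * (K ^+ 2 * (e / (2 * A))) = e / 2 * (2 * K ^+ 2 / A) by field; rewrite gt_eqF.
  by rewrite ler_piMr ?divr_ge0 ?(ltW e0)// ler_pdivrMr// mul1r lerDl.
have t2 : 2 * ((K * (1 - r)) ^+ 2 * M) <= e / 2.
  apply: (@le_trans _ _ (2 * K ^+ 2 * M * (1 - r))).
    have -> : 2 * ((K * (1 - r)) ^+ 2 * M) = 2 * K ^+ 2 * M * (1 - r) * (1 - r) by ring.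
    by rewrite ler_piMr ?mulr_ge0 ?sqr_ge0 ?subr_ge0 ?(ltW r1)// lerBlDr lerDl ltW.
  apply: (@le_trans _ _ (B * (1 - r))).
    by rewrite ler_wpM2r ?subr_ge0 ?(ltW r1)// lerDl.
  move: rB; rewrite ltr_pdivlMr ?mulr_gt0// => /ltW; lra.
by rewrite (le_trans (lerD t1 t2))//; lra.
Qed.

Lemma is_boundary_value_radlip p : radlip p ->
  is_boundary_value p (fun t => p (torus_point t)).
Proof.
move=> rp; have := is_boundary_valueM rp _ is_boundary_value1.
move=> /(_ (fun z _ => differentiable_cst _ _)) h.
have e : (fun t : T => p (torus_point t) * 1) = fun t => p (torus_point t).
  by apply/funext => t; rewrite mulr1.
rewrite e in h; apply: is_boundary_value_ext h => z _; exact: mulr1.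
Qed.

(** Two boundary values are compared through a common dilate. Inner products are thus independent of
    the choice hidden in [boundary_value]. *)
Lemma is_boundary_value_unique f F G : holo f -> is_boundary_value f F ->
  is_boundary_value f G -> \forall t \ae mu, F t = G t.
Proof.
move=> df /is_boundary_valueP[F1 F2 F3] /is_boundary_valueP[G1 G2 G3].
have mFG : measurable_cplx (fun t => F t - G t) by exact: measurable_cplxB.
suff /(msq_eq0 mFG) : msq (fun t => F t - G t) = 0%E.
  by apply: filterS => t /eqP; rewrite subr_eq0 => /eqP.
apply/eqP; rewrite eq_le msq_ge0 andbT; apply/lee_addgt0Pr => e e0; rewrite add0e.
have e4 : 0 < e / 4 by rewrite divr_gt0.
have /filter_ex[r [r01 h1 h2]] : \forall r \near 1^'-, [/\ 0 < r < 1,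
    (msq (fun t => (dilate r f t - F t)%R) <= (e / 4)%:E)%E &
    (msq (fun t => (dilate r f t - G t)%R) <= (e / 4)%:E)%E].
  by apply: filterS3 near_left1 (F3 _ e4) (G3 _ e4) => r *; split.
have mf := dilate_measurable df r01.
rewrite (@eq_msq _ _ _ (fun t => (F t - dilate r f t) + (dilate r f t - G t))); last first.
  by move=> t; rewrite addrA subrK.
apply: le_trans (msqD _ _) _; [exact: measurable_cplxB..|].
rewrite (_ : msq (fun t => F t - dilate r f t) = msq (fun t => dilate r f t - F t)); last first.
  by apply: eq_integral => t _; rewrite normc_distC.
apply: (@le_trans _ _ (2%:E * (e / 4)%:E + 2%:E * (e / 4)%:E)%E).
  by apply: leeD; rewrite lee_wpmul2l.
by rewrite -!EFinM -EFinD lee_fin; lra.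
Qed.

Lemma boundary_valueP f F : is_boundary_value f F -> is_boundary_value f (boundary_value f).
Proof. by move=> fF; rewrite /boundary_value; apply: (@xgetPex _ _ [set F | is_boundary_value f F]); exists F. Qed.

End boundary_values.

(** * Passage to the limit in pairings with dilates *)

Section inner_product_limit.
Variables (R : realType) (n : nat).
Local Notation T := (n.-tuple (measurableTypeR R)).
Local Notation V := ('rV[cplx R]_n).
Local Notation mu := (haar R n).

Lemma msq_integrable (G : T -> R[i]) : measurable_cplx G -> (msq G < +oo)%E ->
  mu.-integrable setT (fun t => (complex.Re (G t))%:E).
Proof.
move=> mG Gf; apply/integrableP; split; first by apply/measurable_EFinP; case: mG.
apply: (@le_lt_trans _ _ (\int[mu]_t (normc (G t))%:E)%E).
  apply: ge0_le_integral => //.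
  - by apply: measurableT_comp => //; apply/measurable_EFinP; case: mG.
  - by apply/measurable_EFinP; exact: measurable_normc.
  - by move=> t _; rewrite lee_fin; have [] := normc_ge_ReIm (G t).
apply: le_lt_trans (mean_le_msq ltr01 mG) _.
by rewrite invr1 mul1e lte_add_pinfty// ltry.
Qed.

Lemma normr_mean_le_msq (G : T -> R[i]) (d : R) : 0 < d -> measurable_cplx G ->
  (msq G < +oo)%E ->
  (`|\int[mu]_t complex.Re (G t)|%:E <= d%:E + d^-1%:E * msq G)%E.
Proof.
move=> d0 mG Gf; have iG := msq_integrable mG Gf.
apply: le_trans (mean_le_msq d0 mG).
rewrite EFin_normr_Rintegral//; apply: le_trans (le_abse_integral _ _ _) _ => //.
  by apply/measurable_EFinP; case: mG.
apply: ge0_le_integral => //.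
- by apply: measurableT_comp => //; apply/measurable_EFinP; case: mG.
- by apply/measurable_EFinP; exact: measurable_normc.
- by move=> t _; rewrite lee_fin; have [] := normc_ge_ReIm (G t).
Qed.

Variables (f p : V -> cplx R) (F : T -> cplx R) (v : R -> R[i]) (k : R[i]) (L : R).
Hypothesis df : forall z, polydisc z -> differentiable f z.
Hypothesis fF : is_boundary_value f F.
Hypothesis rp : radlip p.
Hypothesis L0 : 0 <= L.
Hypothesis vk : forall r : R, 0 < r < 1 -> normc (v r - k) <= L * (1 - r).
Hypothesis fv : forall (r : R) (c : R[i]), 0 < r < 1 ->
  mu.-integrable setT (fun t : T => (complex.Re
     (c * (dilate r f t * ((p (torus_point t))^*)%R) : R[i]))%:E) ->
  (\int[mu]_t (complex.Re (c * (dilate r f t * ((p (torus_point t))^*)%R) : R[i]))%:E =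
   (complex.Re (c * v r))%:E)%E.

Let pair c (G : T -> R[i]) t : R[i] := c * (G t * ((p (torus_point t))^*)%R).

Let normc_conj (z : R[i]) : normc (z^*)%R = normc z.
Proof. by case: z => a b /=; rewrite sqrrN. Qed.

(** Only f is dilated, while p stays on the torus; the pairing is then known exactly by [fv] and the
    rate [vk] gives the limit. The free factor [c] lets a statement on real parts yield imaginary
    parts and both orders of the inner product. *)
Lemma radlip_pairing_limit (c : R[i]) :
  \int[mu]_t complex.Re (c * (F t * ((p (torus_point t))^*)%R) : R[i]) = complex.Re (c * k).
Proof.
have /is_boundary_valueP[mF F2 F3] := fF.
have mp := radlip_torus_measurable rp.
have [dp [K K0 pK]] := rp.
have mpair G : measurable_cplx G -> measurable_cplx (pair c G).
  move=> mG; apply: measurable_cplxM; first exact: measurable_cplx_cst.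
  by apply: measurable_cplxM => //; exact: measurable_cplx_conj.
pose a := normc c; have a0 : 0 <= a := normc_ge0 c.
have msq_pair G : measurable_cplx G -> (msq (pair c G) <= ((a * K) ^+ 2)%:E * msq G)%E.
  move=> mG; apply: msq_le => //; first exact: mpair; first exact: mulr_ge0.
  move=> t; rewrite /pair !normcM normc_conj mulrCA -/a [leRHS]mulrC.
  rewrite ler_wpM2l ?normc_ge0// ler_wpM2l//.
  have [+ _] := pK 1 t ltac:(by rewrite ltr01 lexx).
  by rewrite scale1_torus.
have pair_fin G : measurable_cplx G -> (msq G < +oo)%E -> (msq (pair c G) < +oo)%E.
  move=> mG Gf; apply: le_lt_trans (msq_pair G mG) _.
  by rewrite lte_mul_pinfty// ?lee_fin ?sqr_ge0.
apply/eqP; rewrite -subr_eq0 -normr_le0; apply/ler_addgt0Pr => e e0; rewrite add0r.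
pose A := (a * K) ^+ 2 + 1; have A0 : 0 < A by rewrite ltr_wpDl// sqr_ge0.
pose B := a * L + 1; have B0 : 0 < B by rewrite ltr_wpDl// mulr_ge0.
(* Chosen for [normr_mean_le_msq] with [d = e / 4]: both of its terms are then at most [e / 4]. *)
have e1 : 0 < (e / 4) ^+ 2 / A by rewrite divr_gt0// exprn_gt0// divr_gt0.
have e2 : 0 < e / (2 * B) by rewrite divr_gt0// mulr_gt0.
have /filter_ex[r [r01 rB fFr]] : \forall r \near (1:R)^'-, [/\ 0 < r < 1,
    1 - r < e / (2 * B) &
    (msq (fun t => (dilate r f t - F t)%R) <= ((e / 4) ^+ 2 / A)%:E)%E].
  by apply: filterS3 (@near_left1 R) (nbhs_left_ltBl 1 e2) (F3 _ e1) => r *; split.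
have mf := dilate_measurable df r01.
have mfF : measurable_cplx (fun t => dilate r f t - F t) by exact: measurable_cplxB.
have fFf : (msq (fun t => (dilate r f t - F t)%R) < +oo)%E.
  by apply: le_lt_trans fFr _; rewrite ltry.
have ff : (msq (dilate r f) < +oo)%E.
  rewrite (@eq_msq _ _ _ (fun t => (dilate r f t - F t) + F t)); last first.
    by move=> t; rewrite subrK.
  apply: le_lt_trans (msqD mfF mF) _.
  by rewrite lte_add_pinfty// lte_mul_pinfty.
have i1 := msq_integrable (mpair _ mf) (pair_fin _ mf ff).
have i2 := msq_integrable (mpair _ mF) (pair_fin _ mF F2).
have := fv r01 i1 => h1.
have h2 : \int[mu]_t complex.Re (pair c (dilate r f) t) = complex.Re (c * v r).
  by rewrite /Rintegral h1.
have h3 : \int[mu]_t complex.Re (pair c (dilate r f) t) -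
    \int[mu]_t complex.Re (pair c F t) =
    \int[mu]_t complex.Re (pair c (fun t => dilate r f t - F t) t).
  rewrite -RintegralB//; apply: eq_Rintegral => t _.
  rewrite -raddfB/=; congr complex.Re; rewrite /pair; ring.
have h4 : `|\int[mu]_t complex.Re (pair c (fun t => dilate r f t - F t) t)| <= e / 2.
  rewrite -lee_fin.
  have d0 : 0 < e / 4 by rewrite divr_gt0.
  apply: le_trans (normr_mean_le_msq d0 (mpair _ mfF) (pair_fin _ mfF fFf)) _.
  apply: (@le_trans _ _ ((e / 4)%:E + ((e / 4)^-1)%:E *
      (((a * K) ^+ 2)%:E * ((e / 4) ^+ 2 / A)%:E))%E).
    rewrite leeD2l// lee_wpmul2l ?lee_fin ?invr_ge0 ?(ltW d0)//.
    apply: le_trans (msq_pair _ mfF) _.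
    by rewrite lee_wpmul2l// lee_fin sqr_ge0.
  rewrite -!EFinM -EFinD lee_fin.
  have -> : (e / 4)^-1 * ((a * K) ^+ 2 * ((e / 4) ^+ 2 / A)) = e / 4 * ((a * K) ^+ 2 / A).
    by field; rewrite !gt_eqF.
  have : e / 4 * ((a * K) ^+ 2 / A) <= e / 4.
    by rewrite ler_piMr ?(ltW d0)// ler_pdivrMr// mul1r lerDl.
  lra.
have h5 : `|complex.Re (c * v r) - complex.Re (c * k)| <= e / 2.
  rewrite -raddfB/= -mulrBr.
  have [h _] := normc_ge_ReIm (c * (v r - k)); apply: le_trans h _.
  rewrite normcM -/a; apply: (@le_trans _ _ (a * (L * (1 - r)))).
    by rewrite ler_wpM2l// vk.
  move: rB; rewrite ltr_pdivlMr ?mulr_gt0// => rB.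
  have /andP[r0 r1] := r01.
  apply: (@le_trans _ _ (B * (1 - r))).
    by rewrite mulrA ler_wpM2r ?subr_ge0 ?(ltW r1)// lerDl.
  move: rB; lra.
rewrite -/(pair c F) in h3 *.
rewrite (_ : _ - _ = (complex.Re (c * v r) - complex.Re (c * k)) -
  (complex.Re (c * v r) - \int[mu]_t complex.Re (pair c F t))); last by rewrite /pair; ring.
rewrite -{2}h2 h3 (le_trans (ler_normB _ _))//.
by rewrite (le_trans (lerD h5 h4))//; lra.
Qed.

End inner_product_limit.

(** * The Hardy inner product against a radially Lipschitz function *)

Section hardy_inner_product.
Variables (R : realType) (n : nat).
Local Notation T := (n.-tuple (measurableTypeR R)).
Local Notation V := ('rV[cplx R]_n).
Local Notation mu := (haar R n).
Implicit Types (f p q : V -> cplx R) (r : R).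
Local Notation holo f := (forall z, polydisc z -> differentiable f z).

(** The functions [p] and [q] are separate because a kernel times its cleared denominator equals the
    expected polynomial only where the denominator is nonzero, in particular on the polydisc;
    uniqueness of boundary values there transfers the computation to [q]. *)
Lemma hardy_ip_radlip f p q (v : R -> R[i]) (k : R[i]) (L : R) :
  holo f -> (exists F : T -> cplx R, is_boundary_value f F) ->
  radlip p -> (forall z, polydisc z -> p z = q z) -> 0 <= L ->
  (forall r : R, 0 < r < 1 -> normc (v r - k) <= L * (1 - r)) ->
  (forall (r : R) (c : R[i]), 0 < r < 1 ->
    mu.-integrable setT (fun t : T => (complex.Re
     (c * (dilate r f t * ((p (torus_point t))^*)%R) : R[i]))%:E) ->
    (\int[mu]_t (complex.Re (c * (dilate r f t * ((p (torus_point t))^*)%R) : R[i]))%:E =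
     (complex.Re (c * v r))%:E)%E) ->
  hardy_ip f q = k /\ hardy_ip q f = (k^*)%R.
Proof.
move=> df [F0 /boundary_valueP fF] rp pq L0 vk fv.
have Jc := radlip_pairing_limit df fF rp L0 vk fv.
have pP : is_boundary_value q (fun t => p (torus_point t)).
  exact: is_boundary_value_ext pq (is_boundary_value_radlip rp).
have pQ : is_boundary_value p (boundary_value q).
  by apply: is_boundary_value_ext (boundary_valueP pP) => z /pq.
have /is_boundary_valueP[mF _ _] := fF.
have /is_boundary_valueP[mQ _ _] := pQ.
have mp := radlip_torus_measurable rp.
have aeQ := is_boundary_value_unique rp.1 (is_boundary_value_radlip rp) pQ.
have ReQ (c : R[i]) : \int[mu]_t complex.Re
    (c * (boundary_value f t * ((boundary_value q t)^*)%R) : R[i]) = complex.Re (c * k).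
  rewrite -Jc; congr fine.
  have mc := @measurable_cplx_cst R n c.
  have m1 := measurable_cplxM mc (measurable_cplxM mF (measurable_cplx_conj mQ)).
  have m2 := measurable_cplxM mc (measurable_cplxM mF (measurable_cplx_conj mp)).
  apply: ae_eq_integral => //.
  - by apply/measurable_EFinP; case: m1.
  - by apply/measurable_EFinP; case: m2.
  - by apply: filterS aeQ => t e _; rewrite e.
split.
  rewrite /hardy_ip; apply/eqP; rewrite eq_complex/=; apply/andP; split; apply/eqP.
    by rewrite -[k in RHS]mul1r -ReQ; apply: eq_Rintegral => t _; rewrite mul1r.
  have := ReQ (- 'i); rewrite (_ : complex.Re (- 'i * k) = complex.Im k); last first.
    by case: k {vk Jc ReQ} => a b /=; ring.
  move=> <-; apply: eq_Rintegral => t _.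
  by case: (_ * _) => a b /=; ring.
rewrite /hardy_ip; apply/eqP; rewrite eq_complex/=; apply/andP; split; apply/eqP.
  rewrite (_ : complex.Re _ = complex.Re (1 * k)); last first.
    by rewrite mul1r; case: k {vk Jc ReQ}.
  rewrite -ReQ; apply: eq_Rintegral => t _; rewrite mul1r.
  by case: (boundary_value f t) (boundary_value q t) => a b [c d] /=; ring.
rewrite (_ : complex.Im _ = complex.Re ('i * k)); last first.
  by case: k {vk Jc ReQ} => a b /=; ring.
rewrite -ReQ; apply: eq_Rintegral => t _.
by case: (boundary_value f t) (boundary_value q t) => a b [c d] /=; ring.
Qed.

(** Without a boundary value, [xget] returns its default, the zero function, and every inner product
    with f is 0. *)
Lemma hardy_ip_neq0_boundary_value f g : hardy_ip f g != 0 ->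
  exists F : T -> cplx R, is_boundary_value f F.
Proof.
move=> fg0; apply: contrapT => nF; move/eqP: fg0; apply.
have e : boundary_value f = fun=> 0.
  apply/funext => t; rewrite /boundary_value.
  by rewrite (xgetPN _ (fun F fF => nF (ex_intro _ F fF))).
rewrite /hardy_ip e.
have -> : (fun t : T => complex.Re (0 * ((boundary_value g t)^*)%R : R[i])) = fun=> 0.
  by apply/funext => t; rewrite mul0r.
have -> : (fun t : T => complex.Im (0 * ((boundary_value g t)^*)%R : R[i])) = fun=> 0.
  by apply/funext => t; rewrite mul0r.
by rewrite /Rintegral integral0.
Qed.

Lemma radlip_hardy p : radlip p -> hardy p.
Proof.
move=> [dp [K K0 pK]]; split=> //; exists (K ^+ 2) => r r01.
have r01' : 0 < r <= 1 by case/andP: r01 => -> /ltW ->.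
apply: (@le_trans _ _ (\int[mu]_t (K ^+ 2)%:E)%E).
  apply: ge0_le_integral => //.
  - by move=> t _; rewrite lee_fin sqr_ge0.
  - exact: measurable_normc_sq (dilate_measurable dp r01).
  - move=> t _; rewrite lee_fin ler_pXn2r ?nnegrE ?normc_ge0//.
    by have [] := pK r t r01'.
by rewrite integral_cst//= probability_setT mule1.
Qed.

End hardy_inner_product.

(** * Integrating dilates against weights in one block of variables *)

Section dilate_means.
Variables (R : realType) (n : nat).
Local Notation U := (uniform_prob (@ltr01 R)).
Local Notation T := (n.-tuple (measurableTypeR R)).
Local Notation V := ('rV[cplx R]_n.+1).
Variables (f : V -> cplx R) (r : R) (F : n.+1.-tuple (measurableTypeR R) -> R).
Hypothesis df : forall z, polydisc z -> differentiable f z.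
Hypothesis r01 : 0 < r < 1.
Hypothesis Fi : (haar R n.+1).-integrable setT (EFin \o F).

Definition axis (w : R[i]) : V := row_of (cons_tuple w (ctup0 R n)).

Lemma axis_cdiff w : normc w < 1 -> cdiff (fun w => f (axis w) : R[i]) w.
Proof.
by move=> w1; apply: (hol_head (differentiable_hol df) _ w1); exact: polyd_ctup0.
Qed.

(** A weight in the head alone leaves the integrand holomorphic in the tail, so the tail integral
    moves f to the disc where the tail is 0. *)
Lemma dilate_mean_tail (w : R -> R[i]) (v : R -> R) : measurable_fun setT v ->
  (forall x t, F (tcons x t) = complex.Re (w x * dilate r f (tcons x t))) ->
  (forall x, v x = complex.Re (w x * f (axis (r%:C * cis x)))) ->
  (\int[haar R n.+1]_t (F t)%:E = \int[U]_x (v x)%:E)%E.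
Proof.
move=> mv FE vE; have hf := differentiable_hol df.
apply: (@haar_mean_tail R n
  (fun x s => w x * f (row_of (cons_tuple (r%:C * cis x) s))) _ _ r) => //.
- by move=> h hh hi; exact: haar_mean.
- move=> x; apply: holZ; apply: (hol_tail hf).
  by case/andP: r01 => r0 r1; rewrite normc_polar gtr0_norm.
- by move=> x t; rewrite FE dilate_pol pol_tcons.
Qed.

(** A weight in the tail alone is constant on each circle of the head, and f vanishes at the centre
    of that circle. *)
Lemma dilate_mean_head (w : T -> R[i]) :
  (forall z : V, polydisc z -> z ord0 ord0 = 0 -> f z = 0) ->
  (forall x t, F (tcons x t) = complex.Re (w t * dilate r f (tcons x t))) ->
  (\int[haar R n.+1]_t (F t)%:E = 0)%E.
Proof.
move=> f0 FE; have hf := differentiable_hol df.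
have r01' : 0 <= r < 1 by case/andP: r01 => /ltW ->.
apply: (@haar_mean_head R n
  (fun t z => w t * f (row_of (cons_tuple z (pol r t)))) _ r) => //.
- move=> t z z1; apply: (hol_head (holZ (w t) hf) _ z1); exact: polyd_pol.
- move=> t; rewrite f0 ?mulr0//; last by rewrite mxE tnth0.
  by apply: polydisc_row_of; apply: polyd_cons; [rewrite normc0|exact: polyd_pol].
- by move=> x t; rewrite FE dilate_pol pol_tcons.
Qed.

End dilate_means.

(** * The two kernels and their denominators *)

Section half_kernels.
Variables (R : realType) (m : nat).
Local Notation T n := (n.-tuple (measurableTypeR R)).
Local Notation V := ('rV[cplx R]_m.+2).
Local Notation holo f := (forall z, polydisc z -> differentiable f z).
Implicit Types (z : V) (j : 'I_m.+2).

Definition half : cplx R := (2^-1 : R)%:C.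
(** The constant c of the overview, equal to half the square root of 3. *)
Definition kcoef : cplx R := (Num.sqrt (1 - (2^-1 : R) ^+ 2))%:C.
Definition half_point j : V := \row_k (if k == j then half else 0).
(** A is [fac i1] and B is [fac ord0]; the form of a sum suits [radlipD] and [radlipM]. *)
Definition fac j z : cplx R := 1 + (- half) * z ord0 j.
Definition kfac j z : cplx R := kcoef * (fac j z)^-1.

Lemma conj_real (x : R) : ((x%:C : cplx R)^*)%R = x%:C.
Proof. by apply/eqP; rewrite eq_complex /= oppr0 !eqxx. Qed.

Lemma kcoef_neq0 : kcoef != 0.
Proof.
apply/negP => /eqP[] /eqP; apply/negP; rewrite gt_eqF// sqrtr_gt0 subr_gt0.
by rewrite expr2 -invfM invf_lt1//; lra.
Qed.

Lemma half_kernelE j : hardy_kernel (half_point j) = kfac j.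
Proof.
apply/funext => z; rewrite /hardy_kernel (bigD1 j)//= big1 ?mulr1.
  rewrite mxE eqxx /half normc_real ger0_norm// /kfac /fac conj_real.
  by rewrite mulNr.
move=> k /negbTE kj; rewrite mxE kj normc0 expr0n subr0 sqrtr1.
by rewrite rmorph0 mul0r subr0 divr1.
Qed.

Lemma half_point_polydisc j : polydisc (half_point j).
Proof.
move=> k; rewrite mxE; case: ifP => _; last by rewrite normc0.
by rewrite normc_real ger0_norm// invf_lt1// ltr1n.
Qed.

(** The closed disc is needed: [radlipV] asks for the lower bound at r = 1 too. *)
Lemma fac_ge j z : normc (z ord0 j) <= 1 -> 2^-1 <= normc (fac j z).
Proof.
move=> z1; have : normc (half * z ord0 j) <= 2^-1.
  by rewrite normcM normc_real ger0_norm// ler_piMr.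
have := le_normcD (fac j z) (half * z ord0 j).
rewrite /fac -addrA -mulrDl addNr mul0r addr0 normc1; lra.
Qed.

Lemma fac_neq0 j z : polydisc z -> fac j z != 0.
Proof.
move=> z1; apply/negP => /eqP f0; have := fac_ge (ltW (z1 j)).
by rewrite f0 normc0 leNgt invr_gt0 ltr0n.
Qed.

Lemma radlip_fac j : radlip (fac j).
Proof.
apply: radlipD; first exact: radlip_cst.
by apply: radlipM; [exact: radlip_cst|exact: radlip_coord].
Qed.

Lemma radlip_kfac j : radlip (kfac j).
Proof.
apply: radlipM; first exact: radlip_cst.
have h0 : 0 < 2^-1 :> R by rewrite invr_gt0 ltr0n.
apply: (radlipV h0 (radlip_fac j)); first by move=> z; exact: fac_neq0.
move=> r t /andP[r0 r1]; apply: fac_ge.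
by rewrite !mxE normc_polar gtr0_norm.
Qed.

Lemma kfacM j z : polydisc z -> kfac j z * fac j z = kcoef.
Proof. by move=> z1; rewrite /kfac -mulrA mulVf ?mulr1// fac_neq0. Qed.

Lemma holoM (f g : V -> cplx R) : holo f -> holo g -> holo (fun z => f z * g z).
Proof. by move=> df dg z z1; apply: (differentiableM (df _ z1) (dg _ z1)). Qed.

Definition i1 : 'I_m.+2 := lift ord0 ord0.

Lemma torus_head x (t : T m.+1) : torus_point (tcons x t) ord0 ord0 = cis (x : R).
Proof. by rewrite mxE tnth0. Qed.

Lemma torus_next x (t : T m.+1) :
  torus_point (tcons x t) ord0 i1 = cis (tnth t ord0 : R).
Proof. by rewrite mxE tnthS. Qed.

Lemma axis_head w : (axis m.+1 w : V) ord0 ord0 = w.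
Proof. by rewrite mxE tnth0. Qed.

Lemma axis_next w : (axis m.+1 w : V) ord0 i1 = 0.
Proof. by rewrite mxE tnthS tnth_nseq. Qed.

Lemma axis_polydisc w : normc w < 1 -> polydisc (axis m.+1 w : V).
Proof. by move=> w1; apply/polydisc_row_of/polyd_cons => //; exact: polyd_ctup0. Qed.

End half_kernels.

(** * The inner products occurring in the two identities *)

Section hardy_pairings.
Variables (R : realType) (m : nat).
Local Notation T n := (n.-tuple (measurableTypeR R)).
Local Notation V := ('rV[cplx R]_m.+2).
Local Notation U := (uniform_prob (@ltr01 R)).
Local Notation holo f := (forall z, polydisc z -> differentiable f z).
Local Notation i1 := (@i1 m).
Local Notation axis := (@axis R m.+1).
Local Notation hf := (half R).
Local Notation kc := (kcoef R).
Implicit Types (f p q phi : V -> cplx R) (r : R).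

Definition has_boundary_value f :=
  exists F : T m.+2 -> cplx R, is_boundary_value f F.

(** The derivative in u at the origin; the form with [w - 0] is that of [cdiff] and of
    [integral_circle_coef]. *)
Definition axis_deriv phi (be : R[i]) := forall e : R, 0 < e ->
  exists2 del : R, 0 < del & forall w : R[i], normc (w - 0) < del ->
    normc ((phi (axis w) : R[i]) - phi (axis 0) - be * (w - 0)) <= e * normc (w - 0).

Lemma normc_pol_lt1 r x : 0 < r < 1 -> normc (r%:C * cis x) < 1.
Proof. by move=> /andP[r0 r1]; rewrite normc_polar gtr0_norm. Qed.

Section pairing.
Variables (f p q : V -> cplx R).
Hypotheses (df : holo f) (bf : has_boundary_value f) (rp : radlip p).
Hypothesis pq : forall z, polydisc z -> p z = q z.

Lemma hardy_ip_head_weight_eq0 (P : R -> R[i]) :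
  (forall w, normc w < 1 -> f (axis w) = 0) ->
  (forall x t, p (torus_point (tcons x t)) = P x) ->
  hardy_ip f q = 0.
Proof.
move=> f0 pP.
have [r r01|r c r01 Fi|//] := hardy_ip_radlip df bf rp pq (v := fun=> 0) (k := 0) (lexx 0).
- by rewrite subrr normc0 mul0r.
- rewrite (dilate_mean_tail df r01 Fi (w := fun x => c * ((P x)^*)%R) (v := fun=> 0)).
  + by rewrite integral0 mulr0.
  + exact: measurable_cst.
  + by move=> x t; rewrite pP; congr complex.Re; ring.
  + by move=> x; rewrite f0 ?mulr0// normc_pol_lt1.
Qed.

Lemma hardy_ip_tail_weight_eq0 (P : T m.+1 -> R[i]) :
  (forall z, polydisc z -> z ord0 ord0 = 0 -> f z = 0) ->
  (forall x t, p (torus_point (tcons x t)) = P t) ->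
  hardy_ip f q = 0 /\ hardy_ip q f = 0.
Proof.
move=> f0 pP.
have [r r01|r c r01 Fi|-> ->] := hardy_ip_radlip df bf rp pq (v := fun=> 0) (k := 0) (lexx 0).
- by rewrite subrr normc0 mul0r.
- rewrite (dilate_mean_head df r01 Fi (w := fun t => c * ((P t)^*)%R)).
  + by rewrite mulr0.
  + exact: f0.
  + by move=> x t; rewrite pP; congr complex.Re; ring.
- by rewrite rmorph0.
Qed.

(** With w = r cis x, the conjugated weight 1 - conj (cis x) / 2 turns w phi into w phi - (r / 2)
    phi, since cis x has modulus 1. This is holomorphic in w, and its mean is its value at 0. *)
Lemma hardy_ip_fac phi : holo phi ->
  (forall w, normc w < 1 -> f (axis w) = w * phi (axis w)) ->
  (forall z, p z = kc * fac ord0 z) ->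
  hardy_ip f q = - (kc * hf) * phi (axis 0).
Proof.
move=> dphi fE pE.
set k := - (kc * hf) * phi (axis 0).
have [|r r01|r c r01 Fi|//] := hardy_ip_radlip df bf rp pq
  (v := fun r => k * r%:C) (k := k) (L := normc k).
- exact: normc_ge0.
- rewrite -[X in _ - X]mulr1 -mulrBr normcM ler_wpM2l ?normc_ge0//.
  rewrite -(rmorph1 (real_complex R)) -rmorphB normc_real distrC ger0_norm// subr_ge0.
  by case/andP: r01 => _ /ltW.
- pose g (w : R[i]) : R[i] := (c * kc * w + - (c * kc * hf * r%:C)) * phi (axis w).
  have gd w : normc w < 1 -> cdiff g w.
    move=> w1; pose g' (z : V) : cplx R := (c * kc * z ord0 ord0 + - (c * kc * hf * r%:C)) * phi z.
    have dg : holo g'.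
      apply: (holoM _ dphi) => z _; apply: differentiableD; last exact: differentiable_cst.
      by apply: differentiableM; [exact: differentiable_cst|exact: differentiable_coord].
    have := axis_cdiff dg w1; rewrite /g'.
    by under eq_fun do rewrite axis_head.
  rewrite (dilate_mean_tail df r01 Fi (w := fun x => c * ((kc * (1 + - hf * cis x))^*)%R)
     (v := fun x => complex.Re (g (r%:C * cis x)))).
  + by rewrite integral_circle// /g /k mulr0 add0r; congr (complex.Re _)%:E; ring.
  + apply: continuous_measurable_fun; apply: cdiff_circle_cts; first by case/andP: r01.
    by move=> w wr; apply: gd; rewrite wr; case/andP: r01.
  + by move=> x t; rewrite pE /fac torus_head; congr complex.Re; ring.
  + move=> x; rewrite fE ?normc_pol_lt1//; congr complex.Re; rewrite /g.
    rewrite rmorphM rmorphD rmorph1 rmorphM rmorphN /= !conj_real.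
    rewrite [RHS](_ : _ = (c * kc * (r%:C * cis x) +
       - (c * kc * hf * r%:C * (cis x * ((cis x)^*)%R))) * phi (axis (r%:C * cis x))); last by ring.
    by rewrite mul_cis_conj mulr1.
Qed.

(** The same cancellation is made in v: the conjugated weight turns v phi into (v - r / 2) phi,
    whose tail mean is - (r / 2) phi on the u-axis. The remaining conjugate of u extracts [be] with
    one more factor r. *)
Lemma hardy_ip_facM phi be : holo phi -> axis_deriv phi be ->
  (forall z, polydisc z -> f z = z ord0 i1 * phi z) ->
  (forall z, p z = kc * fac i1 z * z ord0 ord0) ->
  hardy_ip f q = - (kc * hf) * be.
Proof.
move=> dphi dbe fE pE.
set k := - (kc * hf) * be.
have [|r r01|r c r01 Fi|//] := hardy_ip_radlip df bf rp pq
  (v := fun r => k * (r%:C * r%:C)) (k := k) (L := normc k * 2).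
- by rewrite mulr_ge0// normc_ge0.
(* The factor 2 in [L] comes from 1 - r^2 <= 2 (1 - r). *)
- rewrite -[X in _ - X]mulr1 -mulrBr normcM -mulrA ler_wpM2l ?normc_ge0//.
  rewrite -(rmorph1 (real_complex R)) -rmorphM -rmorphB normc_real distrC.
  have /andP[r0 r1] := r01; rewrite ger0_norm; last by rewrite subr_ge0 mulr_ile1// ltW.
  nra.
- pose al := c * kc * - (r%:C * hf).
  have [cts int] := integral_circle_coef al r01 (axis_cdiff dphi) dbe.
  pose f2 (z : V) : cplx R := (z ord0 i1 + - (r%:C * hf)) * phi z.
  have df2 : holo f2.
    apply: (holoM _ dphi) => z _; apply: differentiableD; last exact: differentiable_cst.
    exact: differentiable_coord.
  rewrite (dilate_mean_tail df2 r01 Fi (w := fun x => c * kc * ((cis x)^*)%R)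
     (v := fun x => complex.Re (al * ((cis x)^*)%R * phi (axis (r%:C * cis x))))).
  + by rewrite int; congr (complex.Re _)%:E; rewrite /al /k; ring.
  + exact: continuous_measurable_fun.
  + move=> x t; rewrite pE /fac torus_head torus_next /dilate fE; last exact: polydisc_dilate.
    rewrite /f2; congr complex.Re; set y := phi _.
    rewrite 2!rmorphM rmorphD rmorph1 rmorphM rmorphN /= !conj_real !mxE.
    rewrite tnthS -/(cis _); set cy := cis _.
    rewrite [LHS](_ : _ = c * kc * ((cis x)^*)%R *
       ((r%:C * cy + - (r%:C * hf * (cy * (cy^*)%R))) * y)); last by ring.
    by rewrite mul_cis_conj mulr1.
  + move=> x; rewrite /f2 axis_next add0r /al; congr complex.Re; ring.
Qed.

Lemma hardy_ip_coord : axis_deriv f 0 -> (forall z, p z = z ord0 ord0) ->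
  hardy_ip q f = 0.
Proof.
move=> f0 pE.
have [r r01|r c r01 Fi|_ ->] := hardy_ip_radlip df bf rp pq (v := fun=> 0) (k := 0) (lexx 0).
- by rewrite subrr normc0 mul0r.
- have [cts int] := integral_circle_coef c r01 (axis_cdiff df) f0.
  rewrite (dilate_mean_tail df r01 Fi (w := fun x => c * ((cis x)^*)%R)
     (v := fun x => complex.Re (c * ((cis x)^*)%R * f (axis (r%:C * cis x))))).
  + by rewrite int !mulr0.
  + exact: continuous_measurable_fun.
  + by move=> x t; rewrite pE torus_head; congr complex.Re; ring.
  + by [].
- by rewrite rmorph0.
Qed.

End pairing.
End hardy_pairings.

(** * The two identities and the contradiction *)

(** The increment of k / phi is a multiple of that of phi, which is already o(w); only a lower bound
    on the modulus of phi near 0 has to be added. *)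
Lemma axis_deriv0_inv (R : realType) (m : nat) (f phi : 'rV[cplx R]_m.+2 -> cplx R)
    (k : R[i]) : k != 0 ->
  (forall w, normc w < 1 -> f (axis m.+1 w) * phi (axis m.+1 w) = k) ->
  axis_deriv phi 0 -> axis_deriv f 0.
Proof.
move=> k0 fphi dphi e e0.
have phin w : normc w < 1 -> phi (axis m.+1 w) != 0.
  by move=> /fphi h; apply: contra k0 => /eqP h0; rewrite -h h0 mulr0.
have fE w : normc w < 1 -> f (axis m.+1 w) = k / phi (axis m.+1 w).
  by move=> w1; rewrite -(fphi _ w1) mulfK// phin.
have z1 : normc (0 : R[i]) < 1 by rewrite normc0.
set y0 := phi (axis m.+1 0) in dphi *.
have y00 : y0 != 0 := phin _ z1.
have n0 : 0 < normc y0.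
  by rewrite lt_neqAle normc_ge0 andbT; apply: contra y00 => /eqP/esym/eq0_normc ->.
pose K := normc k + 1; have K0 : 0 < K by rewrite ltr_wpDl// normc_ge0.
pose e' := e * (normc y0 / 2 * normc y0) / K.
have e'0 : 0 < e' by rewrite divr_gt0// !mulr_gt0// divr_gt0.
(* [H1] keeps phi(w) within the distance |w| of [y0], hence of modulus at least half that of [y0];
   [H2] carries the estimate. *)
have [d1 d10 H1] := dphi 1 ltr01; have [d2 d20 H2] := dphi e' e'0.
exists (Num.min (Num.min d1 d2) (Num.min 1 (normc y0 / 2))).
  by rewrite !lt_min d10 d20 ltr01 divr_gt0.
move=> w; rewrite !lt_min => /andP[/andP[/H1 h1 /H2 h2] /andP[w1 wy]].
move: h1 h2 w1 wy; rewrite !mul0r !subr0 mul1r => h1 h2 w1 wy.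
have yn := phin _ w1.
rewrite !fE// -/y0; set y := phi (axis m.+1 w) in h1 h2 yn *.
have ny : normc y0 / 2 <= normc y.
  have := normc_triangle y0 y 0; rewrite !subr0 normc_distC; lra.
have -> : k / y - k / y0 = (k * (y0 - y)) / (y * y0) by field; rewrite yn y00.
rewrite normcM normcV ler_pdivrMr; last first.
  by rewrite normcM mulr_gt0// (lt_le_trans _ ny)// divr_gt0.
rewrite !normcM [normc (y0 - y)]normc_distC.
apply: (@le_trans _ _ (e * normc w * (normc y0 / 2 * normc y0))); last first.
  apply: ler_wpM2l; first by rewrite mulr_ge0 ?normc_ge0// ltW.
  by rewrite ler_wpM2r ?normc_ge0.
apply: (@le_trans _ _ (K * (e' * normc w))).
  apply: ler_pM => //; rewrite ?normc_ge0// /K lerDl//.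
by rewrite /e' le_eqVlt; apply/orP; left; apply/eqP; field; rewrite gt_eqF.
Qed.

Theorem lemma43 (R : realType) (n : nat) (hn : (1 < n)%N) :
  ~ @invertible_multiplier_property R 'rV[cplx R]_n (@polydisc R n)
      (@hardy R n) (@hardy_ip R n) (@hardy_kernel R n).
Proof.
case: n hn => [|[|m]]// _ IMP.
pose a (k : 'I_2) : 'rV[cplx R]_m.+2 :=
  if k == ord0 then half_point R (i1 m) else half_point R ord0.
(* The zero weight removes the term without a kernel, whose entries would not become polynomials. *)
pose theta (k : 'I_3) : R := if k == ord0 then 0 else 2^-1.
have [//|k|k||psi [[psi0 _ Hinv Hpsi npsi] id]] := IMP 2%N a theta.
- by rewrite /a; case: ifP => _; exact: half_point_polydisc.
- by rewrite /theta; case: ifP => _ //; rewrite invr_ge0 ler0n.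
- by rewrite !big_ord_recl big_ord0 /theta/=; lra.
pose kf := @kfac R m; pose fc := @fac R m.
pose co (j : 'I_m.+2) (z : 'rV[cplx R]_m.+2) : cplx R := z ord0 j.
have rk j : radlip (kf j) := radlip_kfac R j.
have rf j : radlip (fc j) := radlip_fac R j.
have rc j : radlip (co j) := radlip_coord R j.
have idE f g : hardy f -> hardy g ->
    hardy_ip (fun z => kf (i1 m) z * f z) (fun z => kf (i1 m) z * g z) +
    hardy_ip (fun z => kf ord0 z * f z) (fun z => kf ord0 z * g z) =
    2%:R * hardy_ip (fun z => psi z * f z) (fun z => psi z * g z).
  have lin (X Y Z W : cplx R) : 0%:C * X + ((2^-1 : R)%:C * Y + ((2^-1 : R)%:C * Z + 0)) = W ->
      Y + Z = 2%:R * W.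
    move=> <-; rewrite mul0r add0r addr0 -mulrDr mulrA.
    rewrite (_ : 2%:R * (2^-1 : R)%:C = 1) ?mul1r//.
    by rewrite -(rmorph_nat (real_complex R)) -rmorphM divff ?rmorph1// pnatr_eq0.
  move=> fH gH; have := id f g fH gH; rewrite !big_ord_recl big_ord0.
  have -> : a ord0 = half_point R (i1 m) by [].
  have -> : a (lift ord0 ord0) = half_point R ord0 by [].
  have -> : theta ord0 = 0 by [].
  have -> : theta (lift ord0 ord0) = 2^-1 by [].
  have -> : theta (lift ord0 (lift ord0 ord0)) = 2^-1 by [].
  rewrite !half_kernelE; exact: lin.
pose chi z := (psi z)^-1.
have pc z : polydisc z -> psi z * chi z = 1.
  by move=> z1; rewrite /chi divff// psi0.
have chiH : hardy chi.
  have := Hinv _ (radlip_hardy (@radlip_cst R m.+2 1)).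
  by under eq_fun do rewrite mulr1.
have dpsi := Hpsi.1; have dchi := chiH.1.
have bext (f g : 'rV[cplx R]_m.+2 -> cplx R) :
    has_boundary_value f -> (forall z, polydisc z -> f z = g z) ->
    has_boundary_value g.
  by move=> [F fF] fg; exists F; exact: is_boundary_value_ext fg fF.
have bM (p f : 'rV[cplx R]_m.+2 -> cplx R) :
    radlip p -> (forall z, polydisc z -> differentiable f z) ->
    has_boundary_value f -> has_boundary_value (fun z => p z * f z).
  by move=> rp df [F fF]; eexists; exact: is_boundary_valueM rp df fF.
have bpsi : has_boundary_value psi.
  apply: (@hardy_ip_neq0_boundary_value _ _ psi psi).
  apply/negP => /eqP h0; move: npsi; rewrite /ip_norm h0 sqrtr0 => /eqP.
  by rewrite eq_sym oner_eq0.
have fn j z : polydisc z -> fc j z != 0 by exact: fac_neq0.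
have kc0 := kcoef_neq0 R.
have kM j z : polydisc z -> kf j z * fc j z = kcoef R by exact: kfacM.
have bchi : has_boundary_value chi.
  have r1 := @radlip_cst R m.+2 1.
  have [//|r r01|r c r01 _|one _] := @hardy_ip_radlip R m.+2 (fun z => psi z * chi z)
     (fun=> 1) (fun z => psi z * chi z) (fun=> 1) 1 0 (holoM dpsi dchi) _ r1
     (fun z z1 => esym (pc z z1)) (lexx 0).
  - exists (fun=> 1); apply: is_boundary_value_ext (is_boundary_value1 R m.+2).
    by move=> z /pc ->.
  - by rewrite subrr normc0 mul0r.
  - rewrite (eq_integral (fun=> (complex.Re c)%:E)); last first.
      by move=> t _; rewrite /dilate pc ?rmorph1 ?mul1r ?mulr1//; exact: polydisc_dilate.
    by rewrite integral_cst//= probability_setT mule1 mulr1.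
  have := idE chi chi chiH chiH; rewrite one mulr1 => sum2.
  (* A kernel can be undone: its inverse is a radially Lipschitz function. *)
  have bk j : has_boundary_value (fun z => kf j z * chi z) -> has_boundary_value chi.
    move=> bj; pose p z := (kcoef R)^-1 * fc j z.
    have rp : radlip p by apply: radlipM (rf j); exact: radlip_cst.
    have h := bM p _ rp (holoM (rk j).1 dchi) bj.
    apply: (bext _ _ h) => z z1.
    rewrite /p [LHS](_ : _ = (kcoef R)^-1 * (kf j z * fc j z) * chi z); last by ring.
    by rewrite kM// mulVf// mul1r.
  (* The two kernel terms add up to 2, so at least one is nonzero. *)
  have [h0|h0] := eqVneq (hardy_ip (fun z => kf (i1 m) z * chi z)
      (fun z => kf (i1 m) z * chi z)) 0; last first.
    exact: bk (hardy_ip_neq0_boundary_value h0).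
  move: sum2; rewrite h0 add0r => h2.
  apply: (bk ord0); apply: (@hardy_ip_neq0_boundary_value _ _ _ (fun z => kf ord0 z * chi z)).
  by rewrite h2 pnatr_eq0.
have bk j l : has_boundary_value (fun z => kf j z * (chi z * co l z)).
  apply: (bext _ _ (bM _ _ (radlipM (rk j) (rc l)) dchi bchi)) => z _.
  by rewrite -mulrA [co l z * _]mulrC.
have dk j l : forall z, polydisc z -> differentiable (fun z => kf j z * (chi z * co l z)) z.
  exact: holoM (rk j).1 (holoM dchi (rc l).1).
have chicoH l : hardy (fun z => chi z * co l z) := Hinv _ (radlip_hardy (rc l)).
pose ff z := fc (i1 m) z * fc ord0 z.
have rff : radlip ff := radlipM (rf _) (rf _).
have bpsip (p : 'rV[cplx R]_m.+2 -> cplx R) : radlip p -> has_boundary_value (fun z => psi z * p z).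
  by move=> rp; apply: (bext _ _ (bM _ _ rp dpsi bpsi)) => z _; rewrite mulrC.
have pcc l z : polydisc z -> co l z = psi z * (chi z * co l z).
  by move=> z1; rewrite mulrA pc// mul1r.
pose phi j z := kf j z * chi z.
have dphi j : forall z, polydisc z -> differentiable (phi j) z := holoM (rk j).1 dchi.
have w0 : normc (0 : R[i]) < 1 by rewrite normc0.
have [be dbe] := axis_cdiff (dphi ord0) w0.
have be0 : be = 0.
  pose g z := ff z * co ord0 z.
  have rg : radlip g := radlipM rff (rc _).
  have := idE _ _ (chicoH (i1 m)) (radlip_hardy rg).
  (* [v * phi_1] vanishes on the u-axis and is paired with c B u, free of v: 0. [v * phi_2] against
     c A u gives [- (c / 2) * be]. On the right, v is free of u while psi A B u is divisible by u:
     0. *)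
  rewrite (@hardy_ip_head_weight_eq0 _ _ _ (fun z => kcoef R * fc ord0 z * co ord0 z) _
    (dk _ _) (bk _ _) _ _ (fun x => kcoef R * (1 + - half R * cis x) * cis x)).
  - rewrite (@hardy_ip_facM _ _ _ (fun z => kcoef R * fc (i1 m) z * co ord0 z) _
      (dk _ _) (bk _ _) _ _ (phi ord0) be (dphi _) dbe).
    + rewrite (@hardy_ip_tail_weight_eq0 _ _ _ (co (i1 m)) _
        (holoM dpsi rg.1) (bpsip _ rg) (rc _) (pcc _)
        (fun t => cis (tnth t ord0 : R)) _ _).2.
      * rewrite add0r mulr0 => /eqP; rewrite mulf_eq0 oppr_eq0 mulf_eq0 (negbTE kc0)/=.
        move=> /orP[/eqP h|/eqP//]; exfalso; move: h => [] /eqP.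
        by rewrite invr_eq0 pnatr_eq0.
      * by move=> z _ z0; rewrite /g /co z0 !mulr0.
      * by move=> x t; rewrite /co torus_next.
    + by apply: radlipM (rc _); apply: radlipM (rf _); exact: radlip_cst.
    + by move=> z z1; rewrite -(kM ord0 z z1) /g /ff; ring.
    + by move=> z _; rewrite /phi /co; ring.
    + by [].
  - by apply: radlipM (rc _); apply: radlipM (rf _); exact: radlip_cst.
  - by move=> z z1; rewrite -(kM (i1 m) z z1) /g /ff; ring.
  - by move=> w w1; rewrite /co axis_next !mulr0.
  - by move=> x t; rewrite /fc /fac /co torus_head.
rewrite be0 in dbe.
have dpf : axis_deriv (fun z => psi z * ff z) 0.
  apply: (axis_deriv0_inv kc0 _ dbe) => w w1.
  have z1 := axis_polydisc (m := m) w1; set z := axis _ _ in z1 *.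
  (* A is 1 on the u-axis, so psi A B and phi_2 have the constant product c there. *)
  have f1 : fc (i1 m) z = 1 by rewrite /fc /fac axis_next mulr0 addr0.
  rewrite -(kM ord0 z z1) /phi /ff f1 mul1r.
  rewrite [LHS](_ : _ = kf ord0 z * fc ord0 z * (psi z * chi z)); last by ring.
  by rewrite pc// mulr1.
have := idE _ _ (chicoH ord0) (radlip_hardy rff).
(* [u * phi_1] against c B gives [- (c / 2) * phi_1(0)]; [u * phi_2] against c A, free of u, gives
   0; u against psi A B gives 0 by [dpf]. *)
rewrite (@hardy_ip_fac _ _ _ (fun z => kcoef R * fc ord0 z) _ (dk _ _) (bk _ _) _ _
  (phi (i1 m)) (dphi _)).
- rewrite (@hardy_ip_tail_weight_eq0 _ _ _ (fun z => kcoef R * fc (i1 m) z) _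
     (dk _ _) (bk _ _) _ _ (fun t => kcoef R * (1 + - half R * cis (tnth t ord0 : R))) _ _).1.
  + rewrite (@hardy_ip_coord _ _ _ (co ord0) _ (holoM dpsi rff.1) (bpsip _ rff)
      (rc _) (pcc _) dpf)//.
    rewrite addr0 mulr0 => /eqP; apply/negP.
    have z1 := axis_polydisc (m := m) w0.
    rewrite mulf_neq0//; last first.
      rewrite /phi /kf /kfac !mulf_neq0 ?invr_eq0 ?fn//; exact: psi0.
    rewrite oppr_eq0 mulf_neq0//; apply/negP => /eqP[] /eqP.
    by rewrite invr_eq0 pnatr_eq0.
  + by apply: radlipM (rf _); exact: radlip_cst.
  + by move=> z z1; rewrite -(kM ord0 z z1) /ff; ring.
  + by move=> z _ z0; rewrite /co z0 !mulr0.
  + by move=> x t; rewrite /fc /fac torus_next.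
- by apply: radlipM (rf _); exact: radlip_cst.
- by move=> z z1; rewrite -(kM (i1 m) z z1) /ff; ring.
- by move=> w _; rewrite /phi /co axis_head; ring.
- by [].
Qed.
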